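(* Let $\boldsymbol{Z}$ be a standard Gaussian random vector in $\mathbb{R}^d$ and suppose the Lévy process $\boldsymbol{X}=(\boldsymbol{X}_t)_{t\ge0}$ in $\mathbb{R}^d$ is in the domain of non-normal attraction of $\boldsymbol{Z}$. Then for any measurable functions $\boldsymbol{A}:[1,\infty)\to\mathbb{R}^d$ and $\boldsymbol{B}:[1,\infty)\to\mathbb{R}^{d\times d}$ such that $\boldsymbol{B}(t)$ is invertible for all sufficiently large $t$, $\boldsymbol{e}_j^\top\boldsymbol{B}(t)^\top\boldsymbol{B}(t)\boldsymbol{e}_j\to\infty$ as $t\to\infty$ for all $j\in\{1,\dots,d\}$, and $\boldsymbol{B}(t)^{-1}\boldsymbol{B}(f(t))\to\boldsymbol{I}_d$ as $t\to\infty$ for all non-decreasing functions $f:[1,\infty)\to[1,\infty)$ with $f(t)/t\to1$ as $t\to\infty$, it holds that $$t\mapsto t^{-1}d_{\mathscr{K}}\big(\boldsymbol{X}_t-\boldsymbol{A}(t),\boldsymbol{B}(t)\boldsymbol{Z}\big)\notin L^1_{\mathrm{loc}}(+\infty).$$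
   Context: $\{\boldsymbol{e}_1,\dots,\boldsymbol{e}_d\}$ is the canonical basis of $\mathbb{R}^d$ and $\boldsymbol{I}_d$ the identity matrix. $\mathscr{K}=\{(-\infty,x_1]\times\cdots\times(-\infty,x_d]:x_1,\dots,x_d\in\mathbb{R}\}$ and $d_{\mathscr{K}}(\boldsymbol{\xi},\boldsymbol{\zeta})=\sup_{A\in\mathscr{K}}|\mathbb{P}(\boldsymbol{\xi}\in A)-\mathbb{P}(\boldsymbol{\zeta}\in A)|$. A non-negative function $h$ is in $L^1_{\mathrm{loc}}(+\infty)$ if $\int_M^\infty h(t)\,\mathrm{d}t<\infty$ for some $M>0$ (with $h$ defined on $[M,\infty)$). A Lévy process $\boldsymbol{X}$ in $\mathbb{R}^d$ is in the domain of attraction (DoA) of $\boldsymbol{Z}$ if there exist measurable functions $\boldsymbol{A}_0:[1,\infty)\to\mathbb{R}^d$ and $\boldsymbol{B}_0:[1,\infty)\to\mathbb{R}^{d\times d}$ such that each $\boldsymbol{B}_0(t)$ is a positive definite symmetric matrix and $\boldsymbol{B}_0(t)^{-1}(\boldsymbol{X}_t-\boldsymbol{A}_0(t))$ converges in distribution to $\boldsymbol{Z}$ as $t\to\infty$. A process in the DoA of $\boldsymbol{Z}$ is in the domain of normal attraction if such functions can be chosen with $\limsup_{t\to\infty}t^{-1/2}\operatorname{tr}(\boldsymbol{B}_0(t))<\infty$; otherwise (i.e. if it is in the DoA but not in the domain of normal attraction) it is in the domain of non-normal attraction. *)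

(* Defs.v *)
From HB Require Import structures.
From mathcomp Require Import all_boot all_order all_algebra.
From mathcomp Require Import all_classical all_reals all_analysis.

Set Implicit Arguments.
Unset Strict Implicit.
Unset Printing Implicit Defensive.

Import Order.TTheory GRing.Theory Num.Theory.
Import numFieldNormedType.Exports.

Local Open Scope classical_set_scope.
Local Open Scope ring_scope.

(* Vectors of R^d are columns ['cV[R]_d = 'M[R]_(d, 1)].  [borel_mx R m n] is
   'M[R]_(m, n) with its Borel sigma-algebra, generated by the open sets of
   the product topology.                                                      *)
Definition borel_mx (R : realType) (m n : nat) : Type :=
  g_sigma_algebraType (@open 'M[R]_(m, n)).

Section probability_notions.
Context {R : realType} {dT : measure_display} {T : measurableType dT}.

Definition random_vector d (xi : T -> 'cV[R]_d) : Prop :=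
  measurable_fun setT (xi : T -> borel_mx R d 1).

Definition mutually_independent {dT' : measure_display}
    {T' : measurableType dT'} (P : probability T R) (I : finType)
    (Y : I -> T -> T') : Prop :=
  forall (J : {set I}) (E : I -> set T'), (forall i, measurable (E i)) ->
    P (\bigcap_(i in [set` J]) (Y i @^-1` E i))
    = (\prod_(i in J) P (Y i @^-1` E i))%E.

Definition standard_gaussian d (P : probability T R) (Z : T -> 'cV[R]_d)
    : Prop :=
  [/\ random_vector Z,
      mutually_independent P (fun (i : 'I_d) w => Z w i 0)
    & forall (i : 'I_d) (E : set R), measurable E ->
        P ((fun w => Z w i 0) @^-1` E) = normal_prob 0 1 E].

(* Only the values at nonnegative times are meaningful. *)
Definition cadlag d (x : R -> 'cV[R]_d) : Prop :=
  (forall t, 0 <= t -> x s @[s --> t^'+] --> x t) /\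
  (forall t, 0 < t -> cvg (x s @[s --> t^'-])).

Record levy_process d (P : probability T R) (X : R -> T -> 'cV[R]_d) : Prop :=
  LevyProcess {
    levy_measurable : forall t, 0 <= t -> random_vector (X t);
    levy_init : {ae P, forall w, X 0 w = 0};
    levy_independent : forall (n : nat) (t : nat -> R),
      0 <= t 0%N -> increasing_seq t ->
      mutually_independent P
        (fun (i : 'I_n) w => X (t i.+1) w - X (t i) w : borel_mx R d 1);
    levy_stationary : forall s t, 0 <= s -> s <= t ->
      forall E : set (borel_mx R d 1), measurable E ->
        P ((fun w => X t w - X s w) @^-1` E) = P (X (t - s) @^-1` E);
    levy_cadlag : {ae P, forall w, cadlag (X ^~ w)} }.

End probability_notions.

Section two_probability_spaces.
Context {R : realType} {dT dT' : measure_display}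
  {T : measurableType dT} {T' : measurableType dT'}.

Definition cvg_in_distribution d (P : probability T R)
    (Y : R -> T -> 'cV[R]_d) (Q : probability T' R) (Z : T' -> 'cV[R]_d)
    : Prop :=
  forall g : 'cV[R]_d -> R,
    continuous g -> (exists M, forall x, `|g x| <= M) ->
    'E_P[g \o Y t]%E @[t --> +oo] --> 'E_Q[g \o Z]%E.

Definition lower_orthants d : set (set 'cV[R]_d) :=
  [set [set y : 'cV[R]_d | forall i, y i 0 <= x i 0] | x in [set: 'cV[R]_d]].

(* The distance depends only on the two laws, so the vectors may live on
   different probability spaces.                                              *)
Definition kolmogorov_dist d (P : probability T R) (xi : T -> 'cV[R]_d)
    (Q : probability T' R) (zeta : T' -> 'cV[R]_d) : \bar R :=
  ereal_sup [set `|P (xi @^-1` A) - Q (zeta @^-1` A)|%E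
            | A in @lower_orthants d].

Definition sym_posdef d (M : 'M[R]_d) : Prop :=
  M^T = M /\ forall v : 'cV[R]_d, v != 0 -> 0 < (v^T *m M *m v) 0 0.

(* Functions on [1, +oo[ are total functions on R whose values outside
   [1, +oo[ are irrelevant.                                                   *)
Definition measurable_from1 m n (F : R -> 'M[R]_(m, n)) : Prop :=
  measurable_fun (`[1, +oo[ : set R) (F : R -> borel_mx R m n).

Definition attracting_norming d (P : probability T R)
    (X : R -> T -> 'cV[R]_d) (Q : probability T' R) (Z : T' -> 'cV[R]_d)
    (A0 : R -> 'cV[R]_d) (B0 : R -> 'M[R]_d) : Prop :=
  [/\ measurable_from1 A0,
      measurable_from1 B0,
      forall t, 1 <= t -> sym_posdef (B0 t)
    & cvg_in_distribution P (fun t w => invmx (B0 t) *m (X t w - A0 t)) Q Z].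

Definition domain_of_attraction d (P : probability T R)
    (X : R -> T -> 'cV[R]_d) (Q : probability T' R) (Z : T' -> 'cV[R]_d)
    : Prop :=
  exists A0 B0, attracting_norming P X Q Z A0 B0.

Definition domain_of_normal_attraction d (P : probability T R)
    (X : R -> T -> 'cV[R]_d) (Q : probability T' R) (Z : T' -> 'cV[R]_d)
    : Prop :=
  exists A0 B0, attracting_norming P X Q Z A0 B0 /\
    (limf_esup (fun t : R => ((Num.sqrt t)^-1 * \tr (B0 t))%:E) +oo%R
       < +oo)%E.

Definition domain_of_nonnormal_attraction d (P : probability T R)
    (X : R -> T -> 'cV[R]_d) (Q : probability T' R) (Z : T' -> 'cV[R]_d)
    : Prop :=
  domain_of_attraction P X Q Z /\ ~ domain_of_normal_attraction P X Q Z.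

End two_probability_spaces.

(* Intended for h nonnegative on a neighbourhood of +oo. *)
Definition L1loc_infty (R : realType) (h : R -> \bar R) : Prop :=
  exists M : R, 0 < M /\
    (\int[lebesgue_measure]_(t in `[M, +oo[) h t < +oo)%E.

(* Main.v *)
(* The argument runs one coordinate at a time: s(t) is the norm of the
   corresponding row of [B t], and d(t) the Kolmogorov distance of that coordinate
   of [X t - A t] to N(0, s(t)^2), supposed integrable against dt/t.
   Since [X] at time 2t is a sum of two independent copies of [X] at time t, and
   the Kolmogorov distance is subadditive under convolution, N(2 A(t), 2 s(t)^2)
   and N(A(2t), s(2t)^2) differ by at most e = 2 d(t) + d(2t); this forces
   s(2t) (1 - c e) <= sqrt 2 s(t).  By Tonelli and the scale invariance of dt/t,
   the sum of d(2^k s) is finite for some s, so s(2^k s) = O(2^(k/2)).  For t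
   between two points of this dyadic sequence, [X t] is at least as concentrated
   as [X] at the next point, hence lies in an interval of length O(sqrt t) with
   probability close to 1.  As the standardized vectors given by the domain of
   attraction charge every ball, the entries of [B0 t] must be O(sqrt t), which
   is normal attraction. *)
Require Import Defs.
From HB Require Import structures.
From mathcomp Require Import all_boot all_order all_algebra.
From mathcomp Require Import all_classical all_reals all_analysis.
From mathcomp Require Import measurable_realfun.
From mathcomp Require Import ring lra.

Set Implicit Arguments.
Unset Strict Implicit.
Unset Printing Implicit Defensive.

Import Order.TTheory GRing.Theory Num.Theory.
Import numFieldNormedType.Exports.

Local Open Scope classical_set_scope.
Local Open Scope ring_scope.

(** * Sums of independent variables *)

(** Two features of the data shape the argument. The centrings are arbitrary: [A] at time 2t need
    not resemble twice [A] at time t, and the interval that catches a coordinate of [X t] between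
    dyadic times has an unknown centre. Hence every comparison is insensitive to translation: the
    scale inequality allows any shift, and a slab is confronted with two opposite balls, so that the
    centre cancels in a difference. Only upper bounds on scales are wanted, since normal attraction
    bounds the trace of [B0] from above; a one-sided recursion therefore suffices. The other feature
    is measurability. The Kolmogorov distance is a supremum over uncountably many orthants, whereas
    Tonelli requires a measurable integrand. It is replaced by a measurable minorant, the supremum
    over rational levels of the differences of the distribution functions of one coordinate. Right
    continuity of distribution functions recovers all real levels, and right continuity of the paths
    gives the measurability in time. *)

Lemma measurable_preimageT d1 d2 (T1 : measurableType d1)
    (T2 : measurableType d2) (f : T1 -> T2) (E : set T2) :
  measurable_fun [set: T1] f -> measurable E -> measurable (f @^-1` E).
Proof. by move=> mf mE; rewrite -[X in measurable X]setTI; exact: mf. Qed.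

Lemma measurable_sublevel d (T : measurableType d) (R : realType) (f : T -> R)
    (y : R) :
  measurable_fun [set: T] f -> measurable [set w | f w <= y].
Proof.
move=> mf; rewrite (_ : [set _ | _] = f @^-1` `]-oo, y]).
  exact: measurable_preimageT.
by apply/seteqP; split => w /=; rewrite in_itv.
Qed.

Lemma measurable_fun_translate (R : realType)
    (nu : probability (measurableTypeR R) R) (E : set R) : measurable E ->
  measurable_fun setT
    (fun x : measurableTypeR R => nu [set y : measurableTypeR R | E (x + y)]).
Proof.
move=> mE; pose W : set (measurableTypeR R * measurableTypeR R) :=
  (fun z => z.1 + z.2) @^-1` E.
rewrite (_ : (fun _ => _) = nu \o xsection W); last first.
  by apply/funext => x /=; rewrite xsectionE.
apply: measurable_fun_xsection; apply: measurable_preimageT => //.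
exact: measurable_funD.
Qed.

Section sums.
Local Open Scope ereal_scope.
Context {R : realType} {d1 d2 : measure_display}
  {T1 : measurableType d1} {T2 : measurableType d2}.

Lemma conv_swap (P : probability T1 R) (Q : probability T2 R)
    (U : T1 -> R) (V : T2 -> R) (E : set R) :
  measurable_fun setT U -> measurable_fun setT V -> measurable E ->
  \int[P]_w Q [set w' | E (U w + V w')%R]
  = \int[Q]_w' P [set w | E (U w + V w')%R].
Proof.
move=> mU mV mE.
pose W : set (T1 * T2) := (fun z => (U z.1 + V z.2)%R) @^-1` E.
have mW : measurable W.
  apply: measurable_preimageT => //; apply: measurable_funD.
    exact: measurableT_comp mU measurable_fst.
  exact: measurableT_comp mV measurable_snd.
have := indic_fubini_tonelli P Q mW.
rewrite indic_fubini_tonelli_FE// indic_fubini_tonelli_GE// => H.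
transitivity (\int[P]_w (Q \o xsection W) w).
  by apply: eq_integral => w _ /=; rewrite xsectionE.
rewrite H; apply: eq_integral => w _ /=; by rewrite ysectionE.
Qed.

(** On rectangles, the image of [P] restricted to [D] under the pair of [U] and [V] agrees with the
    product of [mu] and [nu] scaled by [P D], and rectangles determine a product measure. The
    spectator event [D] serves the induction over Gaussian coordinates, where it constrains
    coordinates outside the sum. *)
Lemma indep_sum_event (P : probability T1 R) (mu nu : probability (measurableTypeR R) R)
    (U V : T1 -> R) (D : set T1) (E : set R) :
  measurable_fun setT U -> measurable_fun setT V -> measurable D ->
  measurable E ->
  (forall F G, measurable F -> measurable G ->
     P (U @^-1` F `&` V @^-1` G `&` D) = mu F * (nu G * P D)) ->
  P ([set w | E (U w + V w)%R] `&` D)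
  = (\int[mu]_x nu [set y | E (x + y)%R]) * P D.
Proof.
move=> mU mV mD mE H.
have mUV : measurable_fun setT
    (fun w => (U w, V w) : measurableTypeR R * measurableTypeR R).
  exact: measurable_fun_pair.
have PD0 : (0 <= fine (P D))%R by exact: fine_ge0.
have PDE : (fine (P D))%:E = P D by rewrite fineK// fin_num_measure.
pose k : {nonneg R} := NngNum PD0.
pose W : set (measurableTypeR R * measurableTypeR R) :=
  (fun z => (z.1 + z.2)%R) @^-1` E.
have mW : measurable W.
  apply: measurable_preimageT => //.
  by apply: measurable_funD.
transitivity ((mu \x mscale k nu) W); last first.
  pose phi : measurableTypeR R -> \bar R := nu \o xsection W.
  have mphi : measurable_fun setT phi by exact: measurable_fun_xsection.
  rewrite (_ : integral mu _ _ = \int[mu]_x phi x); last first.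
    by apply: eq_integral => x _; rewrite /phi /= xsectionE.
  rewrite -ge0_integralZr//.
  by apply: eq_integral => x _ /=; rewrite /mscale/= PDE muleC.
have -> := @product_measure_unique _ _ _ _ _ mu (mscale k nu)
  (@measure_function_pushforward__canonical__measure_function_Measure _ _ _ _ R
   (mrestr P mD) _ mUV) _ _ mW.
- by rewrite /= /pushforward/= /mrestr.
- move=> F G mF mG; rewrite /= /pushforward /= /mrestr /mscale/= PDE (muleC (P D)).
  by rewrite -H//.
Qed.
End sums.

(** * Normal laws *)

Section lebesgue_affine.
Context {R : realType}.
Local Notation mu := (@lebesgue_measure R).

(** Lebesgue measure is determined by half-open intervals; a negative [a] moves the closed end to
    the other side, which leaves the length unchanged. *)
Lemma lebesgue_measure_affine (a b : R) (A : set R) :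
  a != 0 -> measurable A ->
  mu [set x | A (a * x + b)] = (`|a|^-1%:E * mu A)%E.
Proof.
move=> a0 mA.
pose f : measurableTypeR R -> measurableTypeR R := fun x => a * x + b.
have mf : measurable_fun setT f.
  by apply: measurable_funD => //; exact: measurable_funM.
have na0 : 0 < `|a| by rewrite normr_gt0.
pose k : {nonneg R} := NngNum (ltW na0).
pose m := @measure_function_pushforward__canonical__measure_function_Measure
  _ _ _ _ R mu f mf.
suff -> : mu A = mscale k m A.
  rewrite /mscale/= /pushforward/= muleA -EFinM mulVf ?mul1e//.
  by rewrite gt_eqF.
apply: lebesgue_measure_unique => //= _ [[u v] _ <-].
rewrite /mscale/= /pushforward/= /f.
have [uv|vu] := ltP u v; last first.
  by rewrite set_itv_ge ?bnd_simp -?leNgt// preimage_set0 !measure0 mule0.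
have [alt|agt] : a < 0 \/ 0 < a by case: (ltgtP a 0) a0 => //; [left|right].
- rewrite (_ : _ @^-1` _ = `[(v - b) / a, (u - b) / a[%classic); last first.
    apply/seteqP; split => x /=; rewrite !in_itv/= => /andP[h1 h2].
      by rewrite ler_ndivrMr// ltr_ndivlMr// ; apply/andP; split; lra.
    by move: h1 h2; rewrite ler_ndivrMr// ltr_ndivlMr// => ? ?;
      apply/andP; split; lra.
  rewrite !lebesgue_measure_itv/= !lte_fin uv ifT; last first.
    by rewrite ltr_ndivrMr// divfK// ltrD2r.
  rewrite -EFinB -EFinB -EFinM ltr0_norm//; congr EFin.
  by rewrite -mulrBl mulrCA mulNr mulfV//; lra.
- rewrite (_ : _ @^-1` _ = `](u - b) / a, (v - b) / a]%classic); last first.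
    apply/seteqP; split => x /=; rewrite !in_itv/= => /andP[h1 h2].
      by rewrite ltr_pdivrMr// ler_pdivlMr//; apply/andP; split; lra.
    by move: h1 h2; rewrite ltr_pdivrMr// ler_pdivlMr// => ? ?;
      apply/andP; split; lra.
  rewrite !lebesgue_measure_itv/= !lte_fin uv ifT; last first.
    by rewrite ltr_pdivrMr// divfK// ltrD2r.
  rewrite -EFinB -EFinB -EFinM gtr0_norm//; congr EFin.
  by rewrite -mulrBl mulrCA mulfV//; lra.
Qed.

Lemma ge0_integral_affine (a b : R) (f : R -> \bar R) : a != 0 ->
  measurable_fun setT f -> (forall x, 0 <= f x)%E ->
  (\int[mu]_x f (a * x + b)%R = `|a|^-1%:E * \int[mu]_x f x)%E.
Proof.
move=> a0 mf f0.
pose g : measurableTypeR R -> measurableTypeR R := fun x => a * x + b.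
have mg : measurable_fun setT g.
  by apply: measurable_funD => //; exact: measurable_funM.
have na0 : 0 <= `|a|^-1 by rewrite invr_ge0.
pose k : {nonneg R} := NngNum na0.
have := @ge0_integral_pushforward _ _ _ _ R g mg mu setT f measurableT mf
  (fun x _ => f0 x).
rewrite preimage_setT => <-.
rewrite -(@ge0_integral_mscale _ _ R mu _ measurableT k f)//.
apply: eq_measure_integral => A mA _ /=.
  exact: (lebesgue_measure_affine b a0 mA).
Qed.

End lebesgue_affine.

Section normal.
Context {R : realType}.
Local Notation mu := (@lebesgue_measure R).

Lemma normal_pdf_gt0 (m s x : R) : s != 0 -> 0 < normal_pdf m s x.
Proof.
move=> s0; rewrite (normal_pdfE _ s0).
by apply: mulr_gt0; [exact: normal_peak_gt0|exact: expR_gt0].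
Qed.

(** The Radon-Nikodym derivative of [normal_prob] is almost everywhere [normal_pdf], both having the
    same integral over every measurable set; the bound by 1 makes [f] integrable for the change of
    variables. *)
Lemma integral_normal_prob (m s : R) (f : R -> \bar R) :
  measurable_fun setT f -> (forall x, 0 <= f x <= 1)%E ->
  (\int[normal_prob m s]_x f x = \int[mu]_x (f x * (normal_pdf m s x)%:E))%E.
Proof.
move=> mf f01.
have dom := normal_prob_dominates m s.
have intf : (normal_prob m s).-integrable setT f.
  apply/integrableP; split => //.
  apply: (@le_lt_trans _ _ (\int[normal_prob m s]_x (cst 1 x))%E).
    apply: ge0_le_integral => //=; first exact: measurableT_comp.
    by move=> x _; have /andP[h0 h1] := f01 x; rewrite gee0_abs.
  by rewrite integral_cst//= mul1e probability_setT ltry.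
rewrite -(Radon_Nikodym_change_of_variables dom)//=.
apply: ae_eq_integral => //.
- by apply: emeasurable_funM => //; apply/measurable_EFinP.
- apply: emeasurable_funM => //; apply/measurable_EFinP.
  exact: measurable_normal_pdf.
- apply: ae_eqe_mul2l => /=.
  rewrite Radon_NikodymE//=.
  case: cid => /= h [h1 h2 h3].
  apply: integral_ae_eq => //=.
  + by apply/measurableT_comp => //; exact: measurable_normal_pdf.
  + by move=> E E01 mE; rewrite -h3//= .
Qed.

Lemma normal_probE (s : R) (E : set R) : measurable E ->
  normal_prob 0 s E = (\int[mu]_x ((\1_E x)%:E * (normal_pdf 0 s x)%:E))%E.
Proof.
move=> mE; rewrite /normal_prob integral_mkcond; apply: eq_integral => x _.
by rewrite patchE indicE; case: ifP => _; rewrite ?mul1e ?mul0e.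
Qed.

Lemma normal_peakM (s t : R) :
  normal_peak s * normal_peak t = (`|s * t| * pi *+ 2)^-1.
Proof.
rewrite /normal_peak -invfM -sqrtrM; last first.
  by rewrite mulrn_wge0// mulr_ge0 ?sqr_ge0 ?pi_ge0.
congr (_^-1).
rewrite (_ : s ^+ 2 * pi *+ 2 * (t ^+ 2 * pi *+ 2)
            = (s * t * pi *+ 2) ^+ 2); last by ring.
by rewrite sqrtr_sqr -mulrnAr normrM (ger0_norm (mulrn_wge0 _ _)) ?pi_ge0// mulrnAr.
Qed.

Lemma normal_pdf_scale (b s x : R) : b != 0 -> s != 0 ->
  normal_pdf 0 (`|b| * s) (b * x) = `|b|^-1 * normal_pdf 0 s x.
Proof.
move=> b0 s0; have nb0 : `|b| != 0 by rewrite normr_eq0.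
rewrite !normal_pdfE ?mulf_neq0// /normal_fun mulrA; congr (_ * expR _).
  rewrite /normal_peak exprMn -mulrA -mulrnAr sqrtrM ?sqr_ge0// invfM.
  by rewrite sqrtr_sqr normr_id.
rewrite !subr0 exprMn (exprMn _ `|b|) real_normK ?num_real//.
by field; rewrite b0 s0.
Qed.

Lemma normal_prob_scale (b s : R) (E : set R) : b != 0 -> s != 0 ->
  measurable E -> normal_prob 0 s [set x | E (b * x)] = normal_prob 0 (`|b| * s) E.
Proof.
move=> b0 s0 mE.
have mE' : measurable [set x | E (b * x)].
  rewrite (_ : [set _ | _] = ( *%R b) @^-1` E)//.
  by apply: measurable_preimageT => //; exact: measurable_funM.
have nb0 : `|b| != 0 by rewrite normr_eq0.
rewrite (normal_probE _ mE) (normal_probE _ mE').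
pose g x := ((\1_E x)%:E * (normal_pdf 0 (`|b| * s) x)%:E)%E.
have g0 x : (0 <= g x)%E.
  by rewrite mule_ge0// lee_fin ?normal_pdf_ge0.
have mg : measurable_fun setT g.
  apply: emeasurable_funM; apply/measurable_EFinP => //.
  exact: measurable_normal_pdf.
have := ge0_integral_affine 0 b0 mg g0.
move=> /(congr1 (fun z => `|b|%:E * z)%E).
rewrite muleA -EFinM (mulfV nb0) mul1e => <-.
rewrite -ge0_integralZl//.
- apply: eq_integral => x _; rewrite /g addr0 normal_pdf_scale//.
  rewrite -!EFinM; congr EFin.
  by rewrite mulrCA (mulrA `|b|) mulfV// mul1r !indicE.
- rewrite (_ : (fun _ => _) = g \o (fun x => b * x + 0))//.
  apply: measurableT_comp => //.
  by apply: measurable_funD => //; exact: measurable_funM.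
Qed.

(** Completing the square: the joint density of a summand and the sum is the density of the sum at
    [z] times the conditional density of the summand given [z], which is normal with mean
    [z * a ^+ 2 / c ^+ 2] and deviation [a * b / c]. *)
Lemma normal_pdfM (a b x z : R) : a != 0 -> b != 0 ->
  let c := Num.sqrt (a ^+ 2 + b ^+ 2) in
  normal_pdf 0 a x * normal_pdf 0 b (z - x)
  = normal_pdf 0 c z * normal_pdf (z * a ^+ 2 / c ^+ 2) (a * b / c) x.
Proof.
move=> a0 b0 c.
have c20 : 0 < a ^+ 2 + b ^+ 2.
  by rewrite ltr_pwDl ?sqr_ge0// exprn_even_gt0.
have cE : c ^+ 2 = a ^+ 2 + b ^+ 2 by rewrite sqr_sqrtr// ltW.
have c0 : c != 0 by rewrite gt_eqF// sqrtr_gt0.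
rewrite !normal_pdfE ?mulf_neq0 ?invr_eq0//.
rewrite mulrACA normal_peakM [RHS]mulrACA normal_peakM.
rewrite /normal_fun -!expRD; congr (_ * expR _).
  by rewrite mulrCA mulfV// mulr1.
rewrite !subr0 expr_div_n exprMn cE.
by field; rewrite a0 b0 gt_eqF.
Qed.

Lemma normal_prob_conv (a b : R) (E : set R) : a != 0 -> b != 0 ->
  measurable E ->
  (\int[normal_prob 0 a]_x normal_prob 0 b [set y | E (x + y)%R]
   = normal_prob 0 (Num.sqrt (a ^+ 2 + b ^+ 2)) E)%E.
Proof.
move=> a0 b0 mE; set c := Num.sqrt _.
have mEx x : measurable [set y | E (x + y)].
  rewrite (_ : [set _ | _] = (+%R x) @^-1` E)//.
  by apply: measurable_preimageT => //; exact: measurable_funD.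
pose h (z : R * R) := ((\1_E z.2)%:E * (normal_pdf 0 a z.1 * normal_pdf 0 b (z.2 - z.1))%:E)%E.
have h0 z : (0 <= h z)%E.
  by rewrite mule_ge0// lee_fin// mulr_ge0// normal_pdf_ge0.
have mh : measurable_fun [set: measurableTypeR R * measurableTypeR R] h.
  apply: emeasurable_funM; apply/measurable_EFinP.
    exact: measurableT_comp.
  apply: measurable_funM.
    by apply: measurableT_comp => //; exact: measurable_normal_pdf.
  apply: measurableT_comp; first exact: measurable_normal_pdf.
  exact: measurable_funB.
have H x : normal_prob 0 b [set y | E (x + y)]
    = (\int[mu]_z ((\1_E z)%:E * (normal_pdf 0 b (z - x))%:E))%E.
  rewrite (normal_probE _ (mEx x)).
  have := @ge0_integral_affine R 1 x (fun z => (\1_E z)%:E * (normal_pdf 0 b (z - x))%:E)%E (oner_neq0 _).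
  rewrite normr1 invr1 mul1e => <-.
  - by apply: eq_integral => y _; rewrite mul1r addrK !indicE addrC.
  - apply: emeasurable_funM; apply/measurable_EFinP => //.
    apply: measurableT_comp; first exact: measurable_normal_pdf.
    exact: measurable_funB.
  - by move=> y; rewrite mule_ge0// lee_fin// normal_pdf_ge0.
rewrite integral_normal_prob; last 2 first.
- exact: measurable_fun_translate.
- by move=> x; apply/andP; split; [exact: measure_ge0|apply: probability_le1; exact: mEx].
transitivity (\int[mu]_x \int[mu]_z h (x, z))%E.
  apply: eq_integral => x _; rewrite H -ge0_integralZr//.
  - by apply: eq_integral => z _; rewrite /h/= -muleA -EFinM (mulrC (normal_pdf 0 b _)).
  - apply: emeasurable_funM; apply/measurable_EFinP => //.
    apply: measurableT_comp; first exact: measurable_normal_pdf.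
    exact: measurable_funB.
  - by move=> y _; rewrite mule_ge0// lee_fin// normal_pdf_ge0.
  - by rewrite lee_fin normal_pdf_ge0.
rewrite (@fubini_tonelli _ _ _ _ _ mu mu h mh h0) normal_probE//.
apply: eq_integral => z _; rewrite /h/=.
(* By [normal_pdfM] the variable [x] is confined to a conditional density, whose integral is 1. *)
under eq_integral do rewrite normal_pdfM// EFinM muleA.
rewrite ge0_integralZl//=.
- by rewrite integral_normal_pdf mule1.
- by apply/measurable_EFinP; exact: measurable_normal_pdf.
- by move=> x _; rewrite lee_fin normal_pdf_ge0.
- by rewrite mule_ge0// lee_fin ?normal_pdf_ge0.
Qed.

End normal.

(** * Linear combinations of independent standard normal coordinates *)

Section gaussian_combination.
Context {R : realType} {d : nat} {dT' : measure_display}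
  {T' : measurableType dT'} {Q : probability T' R} {Z : T' -> 'cV[R]_d}.
Hypothesis gaussZ : standard_gaussian Q Z.
Hypothesis measZ : forall i, measurable_fun setT (fun w => Z w i 0%R).
Local Open Scope ereal_scope.

Let cylinder (J : {set 'I_d}) (F : 'I_d -> set R) : set T' :=
  \bigcap_(j in [set` J]) (fun w => Z w j 0%R) @^-1` F j.

Let measurable_cylinder J F : (forall j, measurable (F j)) ->
  measurable (cylinder J F).
Proof.
move=> mF; apply: fin_bigcap_measurable.
  by apply: finite_finset.
by move=> j _; exact: measurable_preimageT.
Qed.

(* The centred normal law of variance [v], a point mass when [v = 0]; the
   library's [normal_prob 0 0] is uniform on [0, 1]. *)
Let gauss (v : R) (E : set R) : \bar R :=
  if v == 0%R then \d_(0%R : R) E else normal_prob 0 (Num.sqrt v) E.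

(** The cylinder over indices outside [s] records that the partial sum is independent of the
    remaining coordinates. The induction needs this: to add coordinate [i], its constraint is
    absorbed in the cylinder and the induction hypothesis is applied to [i |: J]. *)
Let gaussian_sum_cylinder (b : 'I_d -> R) (s : seq 'I_d) : uniq s ->
  forall (J : {set 'I_d}) (F : 'I_d -> set R) (E : set R),
  (forall i, i \in s -> i \notin J) ->
  (forall j, measurable (F j)) -> measurable E ->
  Q ([set w | E (\sum_(i <- s) b i * Z w i 0%R)%R] `&` cylinder J F)
  = gauss (\sum_(i <- s) b i ^+ 2)%R E * Q (cylinder J F).
Proof.
have [rvZ indZ lawZ] := gaussZ.
elim: s => [_|i s IH /= /andP[nis us]] J F E sJ mF mE.
  rewrite /gauss big_nil eqxx diracE.
  rewrite (_ : [set w | _] = if 0%R \in E then setT else set0); last first.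
    apply/seteqP; split => w /=; rewrite big_nil.
      by move=> E0; rewrite ifT// inE.
    by case: ifPn => // /set_mem.
  by case: ifP => _; rewrite ?setTI ?set0I ?measure0 ?mul1e ?mul0e.
have [bi0|bi0] := eqVneq (b i) 0%R.
  rewrite big_cons bi0 expr0n add0r -IH//; last first.
    by move=> j js; apply: sJ; rewrite inE js orbT.
  by congr (Q (_ `&` _)); apply/seteqP; split => w /=;
    rewrite big_cons bi0 mul0r add0r.
have iJ : i \notin J by apply: sJ; rewrite mem_head.
have mD := measurable_cylinder J mF.
pose S w := (\sum_(j <- s) b j * Z w j 0%R)%R.
have mS : measurable_fun setT S.
  rewrite /S; apply: measurable_sum => j.
  by apply: measurable_funM.
pose V w := (b i * Z w i 0%R)%R.
have mV : measurable_fun setT V by apply: measurable_funM.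
have sum0 : (0 <= \sum_(j <- s) b j ^+ 2)%R.
  by apply: sumr_ge0 => j _; exact: sqr_ge0.
have mbG G : measurable G -> measurable [set z | G (b i * z)%R].
  move=> mG; rewrite (_ : [set _ | _] = ( *%R (b i)) @^-1` G)//.
  by apply: measurable_preimageT => //; exact: measurable_funM.
have key G1 G2 : measurable G1 -> measurable G2 ->
    Q (S @^-1` G1 `&` V @^-1` G2 `&` cylinder J F)
    = gauss (\sum_(j <- s) b j ^+ 2)%R G1
      * (normal_prob 0 `|b i| G2 * Q (cylinder J F)).
  move=> mG1 mG2.
  pose F' j := if j == i then [set z | G2 (b i * z)%R] else F j.
  have mF' j : measurable (F' j).
    by rewrite /F'; case: ifP => // _; exact: mbG.
  have cylE : cylinder (i |: J) F' = V @^-1` G2 `&` cylinder J F.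
    apply/seteqP; split => w /=.
      move=> h; split.
        by have := h i; rewrite /= setU11 /F' eqxx; exact.
      move=> j /= jJ; have := h j; rewrite /= setU1r// => /(_ isT).
      by rewrite /F' ifN//; apply: contraNneq iJ => <-.
    move=> [h1 h2] j /=; rewrite in_setU1 /F'.
    by case: eqP => [->//|/= _ jJ]; exact: h2.
  have := IH us (i |: J) F' G1 _ mF' mG1; rewrite cylE.
  have -> : Q (V @^-1` G2 `&` cylinder J F)
      = normal_prob 0 `|b i| G2 * Q (cylinder J F).
    have := indZ (i |: J) F' mF'.
    rewrite big_setU1//= {2}/F' eqxx.
    rewrite (eq_bigr (fun j => Q ((fun w => Z w j 0%R) @^-1` F j))); last first.
      move=> j jJ; rewrite /F' ifN//; by apply: contraNneq iJ => <-.
    rewrite -indZ//.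
    rewrite -/(cylinder _ _) cylE => ->; congr (_ * _).
    rewrite lawZ; last exact: mbG.
    by rewrite (normal_prob_scale bi0 (oner_neq0 _) mG2) mulr1.
  rewrite setIA; apply => j js; rewrite in_setU1 negb_or.
  rewrite (sJ j) ?inE ?js ?orbT// andbT.
  by apply: contraNneq nis => <-.
have nbi0 : `|b i|%R != 0%R by rewrite normr_eq0.
rewrite (_ : [set w | _] = [set w | E (S w + V w)%R]); last first.
  by apply/seteqP; split => w /=; rewrite big_cons addrC.
have sumb : (\sum_(j <- i :: s) b j ^+ 2 != 0)%R.
  by rewrite big_cons gt_eqF// ltr_pwDl// exprn_even_gt0.
rewrite /gauss (negbTE sumb) big_cons.
(* If the coefficients over [s] all vanish, the partial sum is a point mass at 0 and the convolution
   is trivial. *)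
have [s0|s0] := eqVneq (\sum_(j <- s) b j ^+ 2)%R 0%R.
  rewrite (@indep_sum_event _ _ _ Q (\d_(0%R : measurableTypeR R)) (normal_prob 0 `|b i|))//; last first.
    by move=> *; rewrite key// /gauss s0 eqxx.
  rewrite integral_dirac// ?diracT ?mul1e.
    rewrite s0 addr0 sqrtr_sqr; congr (_ * _); congr (normal_prob _ _ _).
    by apply/seteqP; split => y /=; rewrite add0r.
  exact: measurable_fun_translate.
rewrite (@indep_sum_event _ _ _ Q
  (normal_prob 0 (Num.sqrt (\sum_(j <- s) b j ^+ 2)%R)) (normal_prob 0 `|b i|))//; last first.
  by move=> *; rewrite key// /gauss (negbTE s0).
have sq0 : (Num.sqrt (\sum_(j <- s) b j ^+ 2) != 0)%R.
  by rewrite sqrtr_eq0 -ltNge lt_neqAle eq_sym s0.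
congr (_ * _); rewrite (normal_prob_conv sq0 nbi0 mE).
have -> : (Num.sqrt (\sum_(j <- s) b j ^+ 2) ^+ 2 + `|b i| ^+ 2
    = b i ^+ 2 + \sum_(j <- s) b j ^+ 2)%R; last by [].
by rewrite (sqr_sqrtr sum0) real_normK ?num_real// addrC.
Qed.

Lemma gaussian_combination (b : 'I_d -> R) (E : set R) :
  (exists i, b i != 0%R) -> measurable E ->
  Q [set w | E (\sum_i b i * Z w i 0%R)%R]
  = normal_prob 0 (Num.sqrt (\sum_i b i ^+ 2)%R) E.
Proof.
move=> [i bi0] mE.
have := @gaussian_sum_cylinder b (index_enum 'I_d) (index_enum_uniq _)
  finset.set0 (fun=> setT) E.
rewrite /cylinder.
have -> : [set` (finset.set0 : {set 'I_d})] = classical_sets.set0.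
  by apply/seteqP; split => j /=; rewrite finset.in_set0.
rewrite bigcap_set0 setIT probability_setT mule1 => -> //; last first.
  by move=> j _; rewrite finset.in_set0.
rewrite /gauss ifN// gt_eqF// (bigD1 i)//= ltr_pwDl ?exprn_even_gt0//.
by apply: sumr_ge0 => j _; exact: sqr_ge0.
Qed.

End gaussian_combination.

(** * Scale comparison for normal laws *)

Section normal_comparison.
Context {R : realType}.

Definition normal_cdf (s x : R) : R := fine (normal_prob 0 s `]-oo, x]).

Lemma normal_cdfE (s x : R) : 0 < s -> normal_cdf s x = normal_cdf 1 (x / s).
Proof.
move=> s0; rewrite /normal_cdf -[in LHS](mulr1 s) -{1}(gtr0_norm s0).
rewrite -normal_prob_scale ?gt_eqF// ?oner_neq0//.
congr (fine (normal_prob _ _ _)).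
by apply/seteqP; split => y /=; rewrite !in_itv/= ler_pdivlMr// mulrC.
Qed.

Lemma normal_cdf_homo (s x y : R) : x <= y -> normal_cdf s x <= normal_cdf s y.
Proof.
move=> xy; apply: fine_le; rewrite ?fin_num_measure//.
by apply: le_measure; rewrite ?inE//; exact: subitvPr.
Qed.

Lemma normal_cdfB (s x y : R) : x <= y ->
  (normal_cdf s y - normal_cdf s x)%:E = normal_prob 0 s `]x, y].
Proof.
move=> xy; rewrite EFinB /normal_cdf !fineK ?fin_num_measure//.
have -> : `]x, y]%classic = `]-oo, y] `\` `]-oo, x].
  by apply/seteqP; split => z /=; rewrite !in_itv/=;
    [move=> /andP[h1 h2]; split => //; apply/negP; rewrite -ltNge|
     move=> [h1 /negP]; rewrite -ltNge => ->].
rewrite measureD ?setIidr//; first exact: subset_itvl.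
by rewrite -ge0_fin_numE// fin_num_measure.
Qed.

(** On [-1, 1] the standard density is smallest at the endpoints, so its value at 1 bounds the slope
    from below. *)
Lemma normal_cdf_increment (x y : R) : -1 <= x -> x <= y -> y <= 1 ->
  normal_pdf 0 1 1 * (y - x) <= normal_cdf 1 y - normal_cdf 1 x.
Proof.
move=> x1 xy y1; rewrite -lee_fin normal_cdfB// /normal_prob.
have -> : ((normal_pdf 0 1 1 * (y - x))%:E =
   \int[lebesgue_measure]_(z in `]x, y]) (normal_pdf 0 1 (1:R))%:E)%E.
  rewrite integral_cst//= lebesgue_measure_itv/= lte_fin.
  have [_|yx] := ltP x y; first by rewrite -EFinB -EFinM.
  by rewrite (_ : y - x = 0) ?mulr0 ?mule0//; lra.
apply: ge0_le_integral => //=.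
- by move=> z _; rewrite lee_fin normal_pdf_ge0.
- by apply/measurable_EFinP; apply: measurable_funTS; exact: measurable_normal_pdf.
- move=> z; rewrite in_itv/= => /andP[xz zy]; rewrite lee_fin.
  rewrite !normal_pdfE ?oner_neq0// ler_pM2l ?normal_peak_gt0 ?oner_neq0//.
  rewrite /normal_fun ler_expR !subr0 !mulNr lerN2 ler_pM2r ?invr_gt0; last first.
    by rewrite expr1n.
  rewrite expr1n; nra.
Qed.

(* Evaluating both distribution functions at [s1] or at [-s1], according to the
   sign of the shift [m], the shift only increases their difference. *)
Lemma normal_scale_comparison (s1 s2 m e : R) : 0 < s1 -> 0 < s2 ->
  (forall x, `|normal_cdf s1 x - normal_cdf s2 (x - m)| <= e) ->
  s2 * (1 - e / normal_pdf 0 1 1) <= s1.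
Proof.
move=> s10 s20 H; set c := normal_pdf 0 1 1.
have c0 : 0 < c by rewrite normal_pdf_gt0// oner_neq0.
have e0 : 0 <= e by apply: le_trans (H 0); exact: normr_ge0.
have [s21|s12] := leP s2 s1.
  apply: le_trans s21; rewrite ler_piMr ?(ltW s20)// gerBl divr_ge0//.
  exact: ltW.
pose u := s1 / s2.
have u0 : 0 < u by rewrite divr_gt0.
have u1 : u < 1 by rewrite /u ltr_pdivrMr// mul1r.
suff : c * (1 - u) <= e.
  move=> h; have : 1 - u <= e / c by rewrite ler_pdivlMr// mulrC.
  rewrite /u => h'; have : 1 - e / c <= s1 / s2 by lra.
  by rewrite ler_pdivlMr// mulrC.
have [m0|m0] := leP 0 m.
  have := H s1; rewrite (normal_cdfE s1)// (normal_cdfE (s1 - m))// mulfV ?gt_eqF//.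
  rewrite ler_norml => /andP[_ h]; apply: le_trans h.
  apply: (@le_trans _ _ (normal_cdf 1 1 - normal_cdf 1 u)).
    by apply: normal_cdf_increment; lra.
  rewrite lerB//; apply: normal_cdf_homo.
  by rewrite /u ler_pM2r ?invr_gt0//; lra.
have := H (- s1); rewrite (normal_cdfE (- s1))// (normal_cdfE (- s1 - m))//.
rewrite mulNr mulfV ?gt_eqF// ler_norml => /andP[h _].
have h1 : c * (- u - -1) <= normal_cdf 1 (- u) - normal_cdf 1 (-1).
  by apply: normal_cdf_increment; lra.
have h2 : normal_cdf 1 (- u) <= normal_cdf 1 ((- s1 - m) / s2).
  by apply: normal_cdf_homo; rewrite /u -mulNr ler_pM2r ?invr_gt0//; lra.
by move: h1 h2; rewrite opprK (addrC (- u)); lra.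
Qed.

End normal_comparison.

(** * Kolmogorov closeness of convolutions *)

Section convolution.
Context {R : realType}.
Implicit Types mu nu : probability (measurableTypeR R) R.
Local Open Scope ereal_scope.

Definition conv_cdf mu nu (x : R) : \bar R :=
  \int[mu]_a nu [set b | (a + b)%R \in `]-oo, x]].

Lemma conv_cdfC mu nu x : conv_cdf mu nu x = conv_cdf nu mu x.
Proof.
rewrite /conv_cdf.
have := @conv_swap R _ _ _ _ mu nu idfun idfun `]-oo, x]
  (@measurable_id _ _ setT) (@measurable_id _ _ setT) (measurable_itv _).
move=> /= ->; apply: eq_integral => b _; congr (mu _).
by apply/seteqP; split => a /=; rewrite addrC.
Qed.

Let measurable_ray a x : measurable [set b : measurableTypeR R | (a + b)%R \in `]-oo, x]].
Proof.
rewrite (_ : [set _ | _] = `]-oo, (x - a)%R]%classic)//.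
by apply/seteqP; split => y /=; rewrite !in_itv/= lerBrDl.
Qed.

Let measurable_conv mu x : measurable_fun setT
  ((fun a => mu [set b : measurableTypeR R | (a + b)%R \in `]-oo, x]]) : measurableTypeR R -> \bar R).
Proof.
exact: (measurable_fun_translate mu (measurable_itv `]-oo, x])).
Qed.

Lemma conv_cdf_le mu nu nu' (e : R) x : (0 <= e)%R ->
  (forall y, nu `]-oo, y]%classic <= nu' `]-oo, y]%classic + e%:E) ->
  conv_cdf mu nu x <= conv_cdf mu nu' x + e%:E.
Proof.
move=> e0 H; rewrite /conv_cdf.
have -> : e%:E = \int[mu]_a e%:E.
  by rewrite integral_cst//= probability_setT mule1.
rewrite -ge0_integralD//.
apply: ge0_le_integral => //=.
- by apply: emeasurable_funD => //; exact: measurable_conv.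
- move=> a _.
  rewrite (_ : [set _ | _] = `]-oo, (x - a)%R]%classic)//.
  by apply/seteqP; split => y /=; rewrite !in_itv/= lerBrDl.
Qed.

(** The factors are replaced one at a time, a uniform bound being integrated against the factor kept
    fixed; commutativity reduces replacing the first factor to replacing the second. *)
Lemma conv_cdf_close mu nu mu' nu' (e f : R) x :
  (forall y, `|fine (mu `]-oo, y]%classic) - fine (mu' `]-oo, y]%classic)| <= e)%R ->
  (forall y, `|fine (nu `]-oo, y]%classic) - fine (nu' `]-oo, y]%classic)| <= f)%R ->
  (`|fine (conv_cdf mu nu x) - fine (conv_cdf mu' nu' x)| <= e + f)%R.
Proof.
move=> He Hf.
have step (m n m' n' : probability (measurableTypeR R) R) :
    (forall y, `|fine (m `]-oo, y]%classic) - fine (m' `]-oo, y]%classic)| <= e)%R ->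
    (forall y, `|fine (n `]-oo, y]%classic) - fine (n' `]-oo, y]%classic)| <= f)%R ->
    conv_cdf m n x <= conv_cdf m' n' x + (e + f)%R%:E.
  move=> he hf.
  have e0 : (0 <= e)%R by apply: le_trans (he 0%R).
  have f0 : (0 <= f)%R by apply: le_trans (hf 0%R).
  apply: (@le_trans _ _ (conv_cdf m n' x + f%:E)).
    apply: (@conv_cdf_le m n n' f x) => // y; have := hf y.
    rewrite ler_norml => /andP[_ h].
    rewrite -[leLHS]fineK ?fin_num_measure// -[X in X + _]fineK ?fin_num_measure//.
    by rewrite -EFinD lee_fin -lerBlDl.
  rewrite conv_cdfC (conv_cdfC m') EFinD addeA leeD2r//.
  apply: (@conv_cdf_le n' m m' e x) => // y; have := he y.
  rewrite ler_norml => /andP[_ h].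
  rewrite -[leLHS]fineK ?fin_num_measure// -[X in X + _]fineK ?fin_num_measure//.
  by rewrite -EFinD lee_fin -lerBlDl.
have fin (m n : probability (measurableTypeR R) R) : conv_cdf m n x \is a fin_num.
  rewrite ge0_fin_numE; last by apply: integral_ge0.
  apply: (@le_lt_trans _ _ (\int[m]_a 1)); last first.
    by rewrite integral_cst//= probability_setT mule1 ltry.
  apply: ge0_le_integral => //=.
  by move=> a _; apply: probability_le1; exact: measurable_ray.
have h1 := step _ _ _ _ He Hf.
have h2 : conv_cdf mu' nu' x <= conv_cdf mu nu x + (e + f)%R%:E.
  by apply: step => y; rewrite distrC.
move: h1 h2; rewrite -(fineK (fin mu nu)) -(fineK (fin mu' nu')) -!EFinD !lee_fin.
by move=> h1 h2; rewrite ler_norml; apply/andP; split; lra.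
Qed.

Lemma conv_cdf_normal (a b : R) x : a != 0%R -> b != 0%R ->
  conv_cdf (normal_prob 0 a) (normal_prob 0 b) x
  = normal_prob 0 (Num.sqrt (a ^+ 2 + b ^+ 2)) `]-oo, x].
Proof. by move=> a0 b0; rewrite -normal_prob_conv. Qed.

End convolution.

Section sum_close.
Context {R : realType} {dT : measure_display} {T : measurableType dT}
  (P : probability T R).

Definition independent2 (U V : T -> R) : Prop :=
  forall F G, measurable F -> measurable G ->
    P (U @^-1` F `&` V @^-1` G) = (P (U @^-1` F) * P (V @^-1` G))%E.

Definition normal_close (U : T -> R) (s e : R) : Prop :=
  forall x, `|fine (P [set w | U w <= x]) - normal_cdf s x| <= e.

Let law (U : T -> R) (mU : measurable_fun setT U) :
    probability (measurableTypeR R) R :=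
  distribution P (@mfun_Sub _ _ T (measurableTypeR R) U (mem_set mU)).

(** Conditioning on [V]: the outer variable freezes the second summand while [U] stays random, the
    form in which a later increment is averaged out. *)
Lemma P_sumE (U V : T -> R) (E : set R) :
  measurable_fun setT U -> measurable_fun setT V -> independent2 U V ->
  measurable E ->
  P [set w | E (U w + V w)] = (\int[P]_w P [set w' | E (U w' + V w)%R])%E.
Proof.
move=> mU mV UV mE.
have := @indep_sum_event R _ T P (law mU) (law mV) U V setT E mU mV
   measurableT mE.
rewrite setIT probability_setT mule1 => ->; last first.
  by move=> F G mF mG; rewrite setIT mule1 UV.
have := @conv_swap R _ _ _ _ (law mU) (law mV) idfun idfun E
  (@measurable_id _ _ setT) (@measurable_id _ _ setT) mE.
move=> /= ->.
rewrite ge0_integral_distribution//.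
have h := measurable_fun_translate (law mU) mE.
apply: eq_measurable_fun h => v _; congr (law mU _).
by apply/seteqP; split => u /=; rewrite addrC.
Qed.

Lemma normal_close_sum (U V : T -> R) (s e : R) : 0 < s ->
  measurable_fun setT U -> measurable_fun setT V -> independent2 U V ->
  normal_close U s e -> normal_close V s e ->
  normal_close (fun w => U w + V w) (Num.sqrt 2 * s) (e + e).
Proof.
move=> s0 mU mV UV HU HV x.
have := @indep_sum_event R _ T P (law mU) (law mV) U V setT `]-oo, x] mU mV
   measurableT (measurable_itv _).
rewrite setIT probability_setT mule1 => H.
rewrite (_ : [set w | U w + V w <= x] = [set w | `]-oo, x]%classic (U w + V w)]); last first.
  by apply/seteqP; split => w /=; rewrite in_itv.
rewrite H; last first.
  by move=> F G mF mG; rewrite setIT mule1 UV.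
have -> : normal_cdf (Num.sqrt 2 * s) x
    = fine (conv_cdf (normal_prob 0 s) (normal_prob 0 s) x).
  have sn0 : s != 0 by rewrite gt_eqF.
  rewrite (conv_cdf_normal _ sn0 sn0) /normal_cdf.
  have -> // : Num.sqrt 2 * s = Num.sqrt (s ^+ 2 + s ^+ 2).
  by rewrite -mulr2n -[in RHS]mulr_natl sqrtrM ?ler0n// sqrtr_sqr gtr0_norm.
apply: conv_cdf_close => y.
- by have := HU y; rewrite /normal_cdf; congr (`|fine (P _) - _| <= _);
    apply/seteqP; split => w /=; rewrite in_itv.
- by have := HV y; rewrite /normal_cdf; congr (`|fine (P _) - _| <= _);
    apply/seteqP; split => w /=; rewrite in_itv.
Qed.

End sum_close.

(** * Coordinates of a Lévy process *)

Section borel_matrices.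
Context {R : realType} {m n : nat} {dT : measure_display}
  {T : measurableType dT}.

Lemma measurable_fun_borel_mx (h : 'M[R]_(m, n) -> R)
    (f : T -> borel_mx R m n) (D : set T) : continuous h ->
  measurable_fun D f -> measurable_fun D (h \o f).
Proof.
move=> /continuousP ch mf.
have mh : measurable_fun setT (h : borel_mx R m n -> R).
  apply: (measurability _ (RGenOpens.measurableE R)) => // _ [_ [a [b ->] <-]].
  by rewrite setTI; apply: sub_sigma_algebra; apply: ch; exact: interval_open.
exact: measurableT_comp mh mf.
Qed.

Lemma measurable_entry (f : T -> borel_mx R m n) (D : set T) i j :
  measurable_fun D f -> measurable_fun D (fun w => f w i j).
Proof.
move=> mf; apply: (@measurable_fun_borel_mx (fun M => M i j)) => //.
exact: coord_continuous.
Qed.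

End borel_matrices.

Lemma random_vector_affine (R : realType) d (dT : measure_display)
    (T : measurableType dT) (xi : T -> 'cV[R]_d) (M : 'M[R]_d) (a : 'cV[R]_d) :
  random_vector xi -> random_vector (fun w => M *m (xi w - a)).
Proof.
move=> mxi; pose h (y : 'cV[R]_d) : 'cV[R]_d := M *m (y - a).
have hE y : h y = \sum_k (y k 0 - a k 0) *: col k M.
  apply/colP => i; rewrite mxE summxE; apply: eq_bigr => k _.
  by rewrite !mxE mulrC.
have ch : continuous h.
  rewrite (_ : h = fun y => \sum_k (y k 0 - a k 0) *: col k M); last exact/funext.
  apply: continuous_big; first exact: (@pseudometric_normed_Zmodule.add_continuous R 'cV[R]_d).
  move=> k _ y.
  have h1 := @cvgB R R^o 'cV[R]_d (nbhs y) _ (fun z => z k 0) (cst (a k 0))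
    (y k 0) (a k 0) (@coord_continuous _ _ _ k 0 y) (cvg_cst _).
  have FF := nbhs_filter y.
  exact: (@cvgZr_tmp R 'cV[R]_d 'cV[R]_d (nbhs y) FF _ _ _ (h1 FF FF)).
have mh : measurable_fun setT (h : borel_mx R d 1 -> borel_mx R d 1).
  apply: (@measurability _ _ (borel_mx R d 1) (borel_mx R d 1) setT h
    (@open 'cV[R]_d)) => // _ [V oV <-].
  rewrite setTI; apply: sub_sigma_algebra.
  by move/continuousP: ch; exact.
exact: measurableT_comp mh mxi.
Qed.

Lemma measurable_entry_preimage (R : realType) m n i j (E : set R) :
  measurable E -> measurable ([set M | E (M i j)] : set (borel_mx R m n)).
Proof.
move=> mE; apply: (@measurable_preimageT _ _ (borel_mx R m n) _
  (fun M : 'M[R]_(m, n) => M i j) E) => //.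
by apply: measurable_entry; exact: measurable_id.
Qed.

Lemma measurable_box (R : realType) d (dT : measure_display)
    (T : measurableType dT) (Y : T -> 'cV[R]_d) (c : 'cV[R]_d) :
  random_vector Y -> measurable [set w | forall k, `|Y w k 0 - c k 0| < 1].
Proof.
move=> mY; rewrite (_ : [set _ | _] = \bigcap_(k in [set: 'I_d])
    (fun w => Y w k 0) @^-1` `]c k 0 - 1, c k 0 + 1[); last first.
  apply/seteqP; split => w /=.
    by move=> h k _ /=; have := h k; rewrite in_itv/= ltr_distl.
  by move=> h k; have := h k I; rewrite /= in_itv/= ltr_distl.
apply: fin_bigcap_measurable; first exact: finite_finset.
by move=> k _; apply: measurable_preimageT => //; exact: measurable_entry.
Qed.

Section levy_coordinates.
Context {R : realType} {d : nat} {dT : measure_display}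
  {T : measurableType dT} {P : probability T R} {X : R -> T -> 'cV[R]_d}.
Hypothesis levyX : levy_process P X.
Variable i : 'I_d.
Let x t w := X t w i 0.

Lemma levy_coord_measurable t : 0 <= t -> measurable_fun setT (x t).
Proof. by move=> t0; apply: measurable_entry; exact: (levy_measurable levyX t0). Qed.

Lemma levy_coord_stationary s t E : 0 <= s -> s <= t -> measurable E ->
  P [set w | E (x t w - x s w)] = P [set w | E (x (t - s) w)].
Proof.
move=> s0 st mE.
have := levy_stationary levyX s0 st (measurable_entry_preimage i 0 mE).
by congr (P _ = _); apply/seteqP; split => w /=; rewrite !mxE.
Qed.

(** The first increment keeps [x 0], which vanishes only almost surely; stationarity later
    identifies its law with that of [x s]. *)
Lemma levy_coord_independent s t : 0 < s -> s < t ->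
  independent2 P (fun w => x s w - x 0 w) (fun w => x t w - x s w).
Proof.
move=> s0 st F G mF mG.
(* The increments wanted lie between the first three times 0, [s], [t]; the values [t + 1], [t + 2],
   ... continue them to an infinite increasing sequence. *)
pose u (n : nat) : R :=
  if n is n'.+1 then if n' is k.+1 then t + k%:R else s else 0.
have iu : increasing_seq u.
  apply/increasing_seqP => -[|[|k]] //=; first by rewrite addr0.
  by rewrite ltrD2l ltr_nat.
have := levy_independent levyX (n := 2) (lexx 0 : 0 <= u 0%N) iu.
pose G' (k : 'I_2) : set (borel_mx R d 1) :=
  if k == ord0 then [set M | F (M i 0)] else [set M | G (M i 0)].
have mG' k : measurable (G' k).
  by rewrite /G'; case: ifP => _; exact: measurable_entry_preimage.
move=> /(_ [set: 'I_2]%SET G' mG').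
rewrite (eq_bigl xpredT); last by move=> k; rewrite finset.in_setT.
rewrite big_ord_recl big_ord_recl big_ord0 mule1 /G' /=.
have -> : (fun w => x s w - x 0 w) @^-1` F
    = (fun w => X s w - X 0 w) @^-1` [set M : 'cV[R]_d | F (M i 0)].
  by apply/seteqP; split => w /=; rewrite !mxE.
have -> : (fun w => x t w - x s w) @^-1` G
    = (fun w => X (t + 0%:R) w - X s w) @^-1` [set M : 'cV[R]_d | G (M i 0)].
  by apply/seteqP; split => w /=; rewrite !mxE addr0.
move=> <-; congr (P _); apply/seteqP; split => w /=.
  move=> [h1 h2] k _ /=; case: ifPn => [/eqP -> //|].
  by case: k => -[|[|//]].
move=> h; split.
  by have := h ord0; rewrite /= finset.in_setT => /(_ isT).
by have := h ord_max; rewrite /= finset.in_setT => /(_ isT).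
Qed.

End levy_coordinates.

(** * Dyadic sequences *)

(** The integral of a nonnegative function is a supremum over the simple functions below it, hence
    monotone even for non-measurable functions. This is how the Kolmogorov distance, whose
    measurability in time is left open, is bounded from below under the integral. *)
Lemma le_integral_minorant d (T : measurableType d) (R : realType)
    (mu : {measure set T -> \bar R}) (D1 D2 : set T) (f g : T -> \bar R) :
  D1 `<=` D2 -> (forall x, D1 x -> (0 <= f x)%E) ->
  (forall x, D2 x -> (0 <= g x)%E) -> (forall x, D1 x -> (f x <= g x)%E) ->
  (\int[mu]_(x in D1) f x <= \int[mu]_(x in D2) g x)%E.
Proof.
move=> D12 f0 g0 fg; rewrite integral_mkcond (integral_mkcond D2).
rewrite !ge0_integralTE; [|by move=> x; exact: erestrict_ge0..].
apply: ereal_sup_le => _ /= [h hf <-]; exists h => // x.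
apply: le_trans (hf x) _; rewrite /patch.
have [xD1|xD1] := boolP (x \in D1).
  by rewrite ifT ?inE; [apply/fg/set_mem|apply/D12/set_mem].
by case: ifP => // /set_mem; exact: g0.
Qed.

Section dyadic.
Context {R : realType}.

Lemma dyadic_bracket (x : R) : 1 <= x ->
  exists k : nat, 2 ^+ k <= x /\ x < 2 ^+ k.+1.
Proof.
move=> x1; pose n := Num.truncn x.
have x0 : 0 <= x by lra.
have n0 : (0 < n)%N by rewrite /n truncn_gt0.
exists (trunc_log 2 n); split.
  apply: le_trans (_ : n%:R <= _); last by rewrite truncn_le.
  by rewrite -natrX ler_nat trunc_logP.
apply: lt_le_trans (truncnS_gt x) _.
by rewrite -natrX ler_nat trunc_log_ltn.
Qed.

Lemma measurable_fun_invr_gt0 : measurable_fun (`]0, +oo[ : set R) (@GRing.inv R).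
Proof.
apply: (eq_measurable_fun (fun x => expR (- ln x))).
  by move=> x; rewrite inE/= in_itv/= andbT => x0; rewrite expRN lnK.
apply: measurable_funTS; apply: measurableT_comp => //.
by apply: measurableT_comp => //; exact: measurable_ln.
Qed.

Lemma dyadic_summable (g : R -> \bar R) (N : R) : 0 < N ->
  measurable_fun setT g -> (forall t, 0 <= g t)%E ->
  (\int[lebesgue_measure]_(t in `[N, +oo[) (t^-1%:E * g t) < +oo)%E ->
  exists2 s, N <= s & (\sum_(k <oo) g (2 ^+ k * s)%R < +oo)%E.
Proof.
move=> N0 mg g0 fin.
pose h t := (t^-1%:E * g t)%E.
have mh : measurable_fun (`[N, +oo[ : set R) h.
  apply: emeasurable_funM; last exact: measurable_funTS.
  apply/measurable_EFinP; apply: measurable_funS measurable_fun_invr_gt0 => //.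
  by move=> t /=; rewrite !in_itv/= !andbT; exact: lt_le_trans.
pose F k : set R := `[2 ^+ k * N, 2 ^+ k.+1 * N[%classic.
have FE : \bigcup_k F k = `[N, +oo[%classic.
  apply/seteqP; split => t /=.
    move=> [k _]; rewrite /F /= !in_itv/= andbT => /andP[h1 _].
    apply: le_trans h1; rewrite ler_peMl ?(ltW N0)// exprn_ege1//; lra.
  rewrite in_itv/= andbT => Nt.
  have [|k [h1 h2]] := @dyadic_bracket (t / N).
    by rewrite ler_pdivlMr// mul1r.
  exists k => //; rewrite /F/= in_itv/=.
  by rewrite -ler_pdivlMr// h1 -ltr_pdivrMr.
have tF : trivIset setT F.
  have lt_disj i j t : (i < j)%N -> F i t -> F j t -> False.
    move=> ij; rewrite /F /= !in_itv/= => /andP[_ h1] /andP[h2 _].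
    have : 2 ^+ i.+1 * N <= 2 ^+ j * N.
      by rewrite ler_pM2r// ler_weXn2l//; lra.
    by move=> h3; move: (lt_le_trans h1 (le_trans h3 h2)); rewrite ltxx.
  move=> i j _ _ [t [Fi Fj]]; have [ij|ji|//] := ltngtP i j.
  - by case: (lt_disj _ _ _ ij Fi Fj).
  - by case: (lt_disj _ _ _ ji Fj Fi).
have mF k : measurable (F k) by exact: measurable_itv.
have h0 t : N <= t -> (0 <= h t)%E.
  move=> Nt; rewrite mule_ge0// lee_fin invr_ge0; lra.
pose D : set R := `[N, 2 * N[%classic.
pose f k x := (x^-1%:E * g (2 ^+ k * x)%R)%E.
have mf k : measurable_fun D (f k).
  apply: emeasurable_funM.
    apply/measurable_EFinP; apply: measurable_funS measurable_fun_invr_gt0 => //.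
    by move=> t; rewrite /D/= !in_itv/= andbT => /andP[/(lt_le_trans N0)].
  by apply: measurable_funTS; apply: measurableT_comp => //; exact: measurable_funM.
have f0 k x : D x -> (0 <= f k x)%E.
  rewrite /D/= in_itv/= => /andP[h1 _].
  by rewrite mule_ge0// lee_fin invr_ge0; lra.
have intF k : (\int[lebesgue_measure]_(t in F k) h t
    = \int[lebesgue_measure]_(x in D) f k x)%E.
  have k0 : 0 < 2 ^+ k :> R by rewrite exprn_gt0.
  have kn0 : 2 ^+ k != 0 :> R by rewrite gt_eqF.
  rewrite integral_mkcond [RHS]integral_mkcond.
  have := @ge0_integral_affine R (2 ^+ k) 0 (h \_ (F k)) kn0.
  have h1 : measurable_fun setT (h \_ (F k)).
    apply/(measurable_restrictT _ (mF k)); apply: measurable_funS mh => //.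
    by rewrite -FE; exact: bigcup_sup.
  have h2 x : (0 <= (h \_ (F k)) x)%E.
    apply: erestrict_ge0 => t; rewrite /F/= in_itv/= => /andP[ht _].
    apply: h0; apply: le_trans ht; rewrite ler_peMl ?(ltW N0)// exprn_ege1//; lra.
  move=> /(_ h1 h2) /(congr1 (fun z => (2 ^+ k)%:E * z)%E).
  rewrite muleA (gtr0_norm k0) -EFinM mulfV// mul1e => <-.
  rewrite -ge0_integralZl//.
  - apply: eq_integral => x _; rewrite /patch addr0.
    have -> : (2 ^+ k * x \in F k) = (x \in D).
      apply/idP/idP; rewrite !inE /F /D /= !in_itv/= exprS => /andP[h3 h4].
        by rewrite -(ler_pM2l k0) h3/= -(ltr_pM2l k0) mulrCA mulrA.
      by rewrite ler_pM2l// h3/= (mulrC 2) -mulrA ltr_pM2l.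
    case: ifPn => [|_]; last by rewrite mule0.
    rewrite inE /D/= in_itv/= => /andP[h3 _].
    (* The Jacobian [2 ^+ k] cancels the same factor in the inverse of [2 ^+ k * x]: this is the
       scale invariance of dt/t. *)
    rewrite /h /f muleA -EFinM invfM mulrA mulfV// mul1r.
    by [].
  - apply: measurableT_comp => //.
    by apply: measurable_funD => //; exact: measurable_funM.
have : (\int[lebesgue_measure]_(x in D) \sum_(k <oo) f k x < +oo)%E.
  rewrite integral_nneseries//; last exact: measurable_itv.
  rewrite (eq_eseriesr (g := fun k => \int[lebesgue_measure]_(t in F k) h t))%E; last first.
    by move=> k _; rewrite intF.
  rewrite -ge0_integral_bigcup//.
  - by rewrite FE.
  - by rewrite FE.
  - by move=> t; rewrite FE/= in_itv/= andbT; exact: h0.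
(* Otherwise the series is infinite at every point of [D], which has positive length [N], and the
   integral is infinite too. *)
apply: contraPP => nsum; rewrite (eq_integral (cst +oo)%E).
  rewrite integral_cst//=; last exact: measurable_itv.
  rewrite lebesgue_measure_itv/= lte_fin ifT; last by lra.
  by rewrite -EFinB gt0_mulye ?ltxx// lte_fin; lra.
move=> x; rewrite inE /D/= in_itv/= => /andP[h1 _].
rewrite nneseriesZl; last by [].
have -> : (\sum_(k <oo) g (2 ^+ k * x)%R = +oo)%E.
  apply/eqP; rewrite -leye_eq leNgt; apply/negP => hx; apply: nsum.
  by exists x.
by rewrite gt0_muley// lte_fin invr_gt0; lra.
Qed.

(** For y between 0 and 1/2, 1 - y is at least exp(-2y). Summability brings [c * e k] below 1/2 from
    some [k0] on, and from there the recursion iterates to a total factor of at most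
    [expR (2 * c * S)]. *)
Lemma bounded_of_summable_defect (r e : nat -> R) (c S : R) : 0 <= c ->
  (forall k, 0 <= r k) -> (forall k, 0 <= e k) ->
  (forall n, \sum_(0 <= k < n) e k <= S) ->
  (forall k, r k.+1 * (1 - c * e k) <= r k) ->
  exists C, forall k, r k <= C.
Proof.
move=> c0 r0 e0 eS H.
have ce : c * e k @[k --> \oo] --> (0 : R).
  rewrite -[X in _ --> X](mulr0 c); apply: cvgMr.
  apply: cvg_series_cvg_0; apply: nondecreasing_is_cvgn.
    by apply/nondecreasing_seqP => n; rewrite /series/= big_nat_recr//= lerDl.
  by exists S => _ [n _ <-]; exact: eS.
have [k0 _ hk0] : \forall k \near \oo, c * e k <= 1 / 2.
  by apply: (cvgr_le _ ce); lra.
(* The second entry covers the finitely many terms before [k0], each at most their sum. *)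
exists (Num.max (r k0 * expR (2 * c * S)) (\sum_(j < k0) r j)) => k.
have [kk0|kk0] := ltnP k k0.
  rewrite le_max; apply/orP; right.
  by rewrite (bigD1 (Ordinal kk0))//= lerDl sumr_ge0.
rewrite le_max; apply/orP; left.
have main n : r (k0 + n)%N <= r k0 * expR (2 * c * \sum_(k0 <= j < k0 + n) e j).
  elim: n => [|n IH].
    by rewrite addn0 big_geq// mulr0 expR0 mulr1.
  rewrite addnS big_nat_recr ?leq_addr//= mulrDr expRD mulrA.
  have h1 : 1 <= (1 - c * e (k0 + n)%N) * expR (2 * c * e (k0 + n)%N).
    have := hk0 (k0 + n)%N (leq_addr _ _).
    have := expR_ge1Dx (2 * c * e (k0 + n)%N).
    have := mulr_ge0 c0 (e0 (k0 + n)%N).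
    rewrite -mulrA; set y := c * _ => y0 hx hy.
    have h2 : (1 - y) * (1 + 2 * y) <= (1 - y) * expR (2 * y).
      by rewrite ler_wpM2l//; lra.
    apply: le_trans h2; nra.
  apply: (@le_trans _ _ (r (k0 + n)%N * expR (2 * c * e (k0 + n)%N))); last first.
    by rewrite ler_pM2r ?expR_gt0.
  apply: (@le_trans _ _ (r (k0 + n).+1 *
      (1 - c * e (k0 + n)%N) * expR (2 * c * e (k0 + n)%N))).
    by rewrite -mulrA ler_peMr.
  by rewrite ler_pM2r ?expR_gt0.
rewrite -(subnKC kk0); apply: le_trans (main _) _.
rewrite ler_wpM2l// ler_expR ler_wpM2l//; first by rewrite mulr_ge0.
apply: le_trans (eS (k0 + (k - k0))%N).
rewrite [leRHS](@big_cat_nat _ _ _ k0)//= ?leq_addr// lerDr.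
by apply: sumr_ge0 => j _.
Qed.

End dyadic.

(** * One coordinate of the process at two related times *)

Section levy_scales.
Context {R : realType} {d : nat} {dT : measure_display}
  {T : measurableType dT} {P : probability T R} {X : R -> T -> 'cV[R]_d}.
Hypothesis levyX : levy_process P X.
Variable i : 'I_d.
Let x t w := X t w i 0.

Let mx t : 0 <= t -> measurable_fun setT (x t).
Proof. exact: levy_coord_measurable levyX i t. Qed.

Let minc s t : 0 <= s -> 0 <= t -> measurable_fun setT (fun w => x t w - x s w).
Proof. by move=> s0 t0; apply: measurable_funB; exact: mx. Qed.

Let increment_law s t E : 0 <= s -> s <= t -> measurable E ->
  P [set w | E (x t w - x s w)] = P [set w | E (x (t - s) w)].
Proof. exact: levy_coord_stationary levyX i s t E. Qed.

(** The law of [x u] is an average, over the independent increment from [t] to [u], of translates of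
    the law of [x t]. If every translate of the interval had probability at most [q] for [x t], so
    would the average. The centre [b] obtained is not controlled. *)
Lemma levy_coord_concentrated (t u a r q : R) : 0 < t -> t < u ->
  (q%:E < P [set w | a - r < x u w <= a + r]%R)%E ->
  exists b, (q%:E < P [set w | b - r < x t w <= b + r]%R)%E.
Proof.
move=> t0 tu.
have u0 := lt_trans t0 tu.
pose I : set R := `]a - r, a + r]%classic.
have PE : P [set w | a - r < x u w <= a + r]
    = P [set w | I ((x t w - x 0 w) + (x u w - x t w))].
  have := increment_law (lexx 0) (ltW u0) (measurable_itv `]a - r, a + r]).
  rewrite subr0.
  have -> : [set w | `]a - r, a + r]%classic (x u w)] = [set w | a - r < x u w <= a + r].
    by apply/seteqP; split => w /=; rewrite in_itv.
  move=> <-; congr (P _); apply/seteqP; split => w /=;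
    rewrite /I/= !in_itv/= => /andP[h1 h2]; apply/andP; split; lra.
rewrite PE (@P_sumE R _ T P (fun w => x t w - x 0 w) (fun w => x u w - x t w) I
   (minc (lexx 0) (ltW t0)) (minc (ltW t0) (ltW u0))
   (levy_coord_independent levyX i t0 tu) (measurable_itv _)) => H.
apply: contrapT => nb.
move: H; apply/negP; rewrite -leNgt.
(* For negative [q] any centre works; nonnegativity is used to compare the integrals. *)
have q0 : (0 <= q%:E)%E.
  rewrite leNgt; apply/negP => q0; apply: nb; exists 0.
  exact: lt_le_trans q0 (measure_ge0 _ _).
have -> : q%:E = (\int[P]_w q%:E)%E.
  by rewrite integral_cst//= probability_setT mule1.
apply: le_integral_minorant => // w _.
rewrite leNgt; apply/negP => h; apply: nb.
pose b := a - (x u w - x t w); exists b.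
suff <- : P [set w' | I ((x t w' - x 0 w') + (x u w - x t w))]
    = P [set w' | b - r < x t w' <= b + r] by [].
have := increment_law (lexx 0) (ltW t0) (measurable_itv `]b - r, b + r]).
rewrite subr0.
have -> : [set w' | `]b - r, b + r]%classic (x t w')]
    = [set w' | b - r < x t w' <= b + r].
  by apply/seteqP; split => w' /=; rewrite in_itv.
move=> <-; congr (P _); apply/seteqP; split => w' /=;
  rewrite /I /b /= !in_itv/= => /andP[h1 h2]; apply/andP; split; lra.
Qed.

Lemma levy_coord_doubling (t a s e : R) : 0 < t -> 0 < s ->
  normal_close P (fun w => x t w - a) s e ->
  normal_close P (fun w => x (2 * t) w - 2 * a) (Num.sqrt 2 * s) (e + e).
Proof.
move=> t0 s0 H.
have t2 : t < 2 * t by lra.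
have t20 : 0 < 2 * t by lra.
have close_inc u v : 0 <= u -> u <= v -> v - u = t ->
    normal_close P (fun w => x v w - x u w - a) s e.
  move=> u0 uv vu z; have := H z.
  have := increment_law u0 uv (measurable_itv `]-oo, z + a]).
  rewrite vu.
  have -> : [set w | `]-oo, z + a]%classic (x t w)] = [set w | x t w - a <= z].
    by apply/seteqP; split => w /=; rewrite in_itv/= lerBlDr.
  move=> <-.
  have -> // : [set w | `]-oo, z + a]%classic (x v w - x u w)]
    = [set w | x v w - x u w - a <= z].
  by apply/seteqP; split => w /=; rewrite in_itv/=; lra.
have ind : independent2 P (fun w => x t w - x 0 w - a) (fun w => x (2 * t) w - x t w - a).
  move=> F G mF mG.
  have mFa (E : set R) : measurable E -> measurable [set y | E (y - a)].
    move=> mE; rewrite (_ : [set _ | _] = (fun y : R => y - a) @^-1` E)//.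
    by apply: measurable_preimageT => //; exact: measurable_funB.
  exact: (levy_coord_independent levyX i t0 t2 (mFa _ mF) (mFa _ mG)).
have c1 : normal_close P (fun w => x t w - x 0 w - a) s e.
  by apply: close_inc; rewrite ?subr0// ltW.
have c2 : normal_close P (fun w => x (2 * t) w - x t w - a) s e.
  by apply: close_inc; lra.
have m1 : measurable_fun setT (fun w => x t w - x 0 w - a).
  by apply: measurable_funB => //; apply: minc; lra.
have m2 : measurable_fun setT (fun w => x (2 * t) w - x t w - a).
  by apply: measurable_funB => //; apply: minc; lra.
move=> z; have := normal_close_sum s0 m1 m2 ind c1 c2 z.
have := increment_law (lexx 0) (ltW t20) (measurable_itv `]-oo, z + 2 * a]).
rewrite subr0.
have -> : [set w | `]-oo, z + 2 * a]%classic (x (2 * t) w)]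
    = [set w | x (2 * t) w - 2 * a <= z].
  by apply/seteqP; split => w /=; rewrite in_itv/= lerBlDr.
move=> <-.
have -> // : [set w | `]-oo, z + 2 * a]%classic (x (2 * t) w - x 0 w)]
    = [set w | x t w - x 0 w - a + (x (2 * t) w - x t w - a) <= z].
by apply/seteqP; split => w /=; rewrite in_itv/=; lra.
Qed.

Lemma levy_coord_scale (t a b s s' e e' : R) : 0 < t -> 0 < s -> 0 < s' ->
  normal_close P (fun w => x t w - a) s e ->
  normal_close P (fun w => x (2 * t) w - b) s' e' ->
  s' * (1 - (e + e + e') / normal_pdf 0 1 1) <= Num.sqrt 2 * s.
Proof.
move=> t0 s0 s'0 H H'.
(* The two centrings are unrelated; their mismatch [b - 2 * a] enters as the free shift of the
   comparison. *)
apply: (@normal_scale_comparison R _ _ (b - 2 * a)) => //.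
  by rewrite mulr_gt0// sqrtr_gt0; lra.
move=> z; have h1 := levy_coord_doubling t0 s0 H z.
have := H' (z - (b - 2 * a)).
have -> : [set w | x (2 * t) w - b <= z - (b - 2 * a)]
    = [set w | x (2 * t) w - 2 * a <= z].
  by apply/seteqP; split => w /=; lra.
rewrite distrC in h1 => h2.
exact: le_trans (ler_distD _ _ _) (lerD h1 h2).
Qed.

End levy_scales.

(** * Slabs and balls *)

Section slab.
Context {R : realType} {d : nat} {dT : measure_display}
  {T : measurableType dT} (P : probability T R).

Lemma setI_neq0_of_probability (S B : set T) (p : R) :
  measurable S -> measurable B ->
  ((1 - p)%:E < P S)%E -> (p%:E <= P B)%E -> exists w, S w /\ B w.
Proof.
move=> mS mB hS hB; apply: contrapT => nw.
have SB : S `&` B = set0.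
  by apply/seteqP; split => // w [? ?]; apply: nw; exists w.
have := probability_le1 P (measurableU _ _ mS mB).
rewrite measureU//; apply/negP; rewrite -ltNge.
have -> : 1%E = ((1 - p)%:E + p%:E)%E by rewrite -EFinD subrK.
by rewrite lte_leD// fin_num_measure.
Qed.

Let centre (j : 'I_d) (b : bool) : 'cV[R]_d :=
  ((-1) ^+ b * d.+1%:R) *: delta_mx j 0.

(* A slab of half-width [r] having probability more than [1 - p] meets the balls
   of radius 1 about both [(d + 1) e_j] and [- (d + 1) e_j], which pins the
   largest coefficient of its normal vector. *)
Lemma row_bound_of_slab (M : 'M[R]_d) (a0 : 'cV[R]_d) (X : T -> 'cV[R]_d)
    (i : 'I_d) (a r p : R) :
  random_vector X -> M \in unitmx ->
  ((1 - p)%:E < P [set w | a - r < X w i 0 <= a + r]%R)%E ->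
  (forall j b, (p%:E <= P [set w | forall k,
      `|(invmx M *m (X w - a0)) k 0 - centre j b k 0| < 1]%R)%E) ->
  forall j, `|M i j| <= r.
Proof.
move=> mX uM hS hB j0.
pose Y w := invmx M *m (X w - a0).
have mS : measurable [set w | a - r < X w i 0 <= a + r].
  rewrite (_ : [set _ | _] = (fun w => X w i 0) @^-1` `]a - r, a + r]); last first.
    by apply/seteqP; split => w /=; rewrite in_itv.
  by apply: measurable_preimageT => //; exact: measurable_entry.
have mB (c : 'cV[R]_d) : measurable [set w | forall k, `|Y w k 0 - c k 0| < 1].
  by apply: measurable_box; exact: random_vector_affine.
pose j := [arg max_(l > j0) `|M i l|]%O.
have jmax l : `|M i l| <= `|M i j|.
  by rewrite /j; case: arg_maxP => // l' _; apply.
suff : `|M i j| <= r by apply: le_trans.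
have [w [Sw Bw]] := setI_neq0_of_probability mS (mB _) hS (hB j false).
have [w' [Sw' Bw']] := setI_neq0_of_probability mS (mB _) hS (hB j true).
have XE v : X v i 0 = a0 i 0 + \sum_l M i l * Y v l 0.
  have : M *m Y v = X v - a0 by rewrite /Y mulmxA mulmxV// mul1mx.
  move=> /(congr1 (fun N : 'cV[R]_d => N i 0)); rewrite mxE => ->.
  by rewrite !mxE addrCA subrr addr0.
pose D l := (Y w l 0 - centre j false l 0) - (Y w' l 0 - centre j true l 0).
have D2 l : `|D l| <= 2.
  apply: le_trans (ler_normB _ _) _.
  have := Bw l; have := Bw' l; rewrite -/(Y w) -/(Y w') => h1 h2.
  by have := ltrD h2 h1 => /ltW /le_trans; apply; lra.
have key : X w i 0 - X w' i 0 = 2 * d.+1%:R * M i j + \sum_l M i l * D l.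
  rewrite !XE.
  have -> : 2 * d.+1%:R * M i j = \sum_l M i l * (centre j false l 0 - centre j true l 0).
    rewrite (bigD1 j)//= big1 ?addr0.
      by rewrite /centre !mxE !eqxx/= expr0 expr1; ring.
    by move=> l lj; rewrite /centre !mxE (negbTE lj)/= !mulr0 subrr mulr0.
  rewrite opprD addrACA subrr add0r -sumrB -big_split/=.
  by apply: eq_bigr => l _; rewrite /D; ring.
have sumD : `|\sum_l M i l * D l| <= d%:R * (2 * `|M i j|).
  apply: le_trans (ler_norm_sum _ _ _) _.
  apply: (@le_trans _ _ (\sum_(l < d) (2 * `|M i j|))).
    by apply: ler_sum => l _; rewrite normrM mulrC ler_pM.
  by rewrite sumr_const card_ord -[leLHS]mulr_natl.
have Xd : `|X w i 0 - X w' i 0| <= 2 * r.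
  move: Sw Sw' => /= /andP[? ?] /andP[? ?].
  by rewrite ler_norml; apply/andP; split; lra.
have : 2 * d.+1%:R * `|M i j| <= `|X w i 0 - X w' i 0| + `|\sum_l M i l * D l|.
  rewrite key -{1}[2]ger0_norm ?ler0n// -{1}[d.+1%:R]ger0_norm ?ler0n//.
  rewrite -!normrM; set u := 2 * _ * _; set v := \sum_(l < d) _.
  by have := ler_normB (u + v) v; rewrite addrK.
(* The centres contribute [2 * (d + 1)] times the largest coefficient, the deviations at most
   [2 * d] times it. What remains is twice that coefficient, at most the slab width [2 * r]; hence
   the choice of [d + 1]. *)
rewrite -natr1; nra.
Qed.

End slab.

(** * Mass of balls under a Gaussian limit *)

Section gaussian_balls.
Context {R : realType} {d : nat} {dT dT' : measure_display}
  {T : measurableType dT} {T' : measurableType dT'}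
  (P : probability T R) (Q : probability T' R).

Lemma normal_prob_itv_gt0 (a b : R) : a < b ->
  (0 < normal_prob 0 1 (`]a, b[ : set R))%E.
Proof.
(* [M] bounds every point of the interval in absolute value, so the density at [M], which is [c]
   below, is a lower bound for the density there. *)
move=> ab; pose M := `|a| + `|b|.
pose c := normal_peak 1 * expR (- M ^+ 2 / (1 ^+ 2 *+ 2)).
have c0 : 0 < c by rewrite mulr_gt0 ?normal_peak_gt0 ?oner_neq0// expR_gt0.
apply: (@lt_le_trans _ _ (\int[lebesgue_measure]_(z in `]a, b[) c%:E)%E).
  rewrite integral_cst//= lebesgue_measure_itv/= lte_fin ab -EFinB -EFinM lte_fin.
  by rewrite mulr_gt0// subr_gt0.
apply: ge0_le_integral => //=.
- by move=> z _; rewrite lee_fin ltW.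
- by apply/measurable_EFinP; apply: measurable_funTS; exact: measurable_normal_pdf.
- move=> z; rewrite in_itv/= => /andP[az zb]; rewrite lee_fin.
  rewrite normal_pdfE ?oner_neq0// /c /normal_fun ler_pM2l; last first.
    by rewrite normal_peak_gt0 ?oner_neq0.
  rewrite ler_expR subr0 !mulNr lerN2 ler_pM2r; last by rewrite invr_gt0 expr1n.
  rewrite -[leLHS]real_normK ?num_real// lerXn2r ?nnegrE ?addr_ge0//.
  rewrite ler_norml /M; apply/andP; split.
    have := lerNnormlW (lexx `|a|); have := normr_ge0 b; lra.
  have := ler_norm b; have := normr_ge0 a; lra.
Qed.

(** A tent for the maximum norm: a bounded continuous test function lying between half the indicator
    of the ball of radius 1/2 and the indicator of the ball of radius 1, so that convergence in
    distribution transfers mass between balls. *)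
Let bump (c y : 'cV[R]_d) : R := Num.max 0 (1 - `|y - c|).

Let continuous_bump c : continuous (bump c).
Proof.
move=> y.
have : {for y, continuous ((cst 0 : 'cV[R]_d -> R^o)
    \max ((fun y => 1 - `|y - c|) : 'cV[R]_d -> R^o))}; last by [].
apply: continuous_max; first exact: cst_continuous.
have h1 : (fun z => `|z - c|) z @[z --> y] --> `|y - c|.
  have h := @cvgB R 'cV[R]_d 'cV[R]_d (nbhs y) _ id (cst c) y c cvg_id (cvg_cst c).
  exact: cvg_norm (h _ _).
rewrite /prop_for /continuous_at /=.
have h2 := @cvgB R R^o 'cV[R]_d (nbhs y) _
  (cst (1 : R^o)) (fun z => `|z - c|) (1 : R^o) `|y - c| (cvg_cst (1 : R^o)) h1.
exact: (h2 _ _).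
Qed.

Let bump01 c y : 0 <= bump c y <= 1.
Proof.
rewrite /bump le_max lexx/= ge_max ler01/=.
by rewrite gerBl.
Qed.

Let bump_gt0 c y : 0 < bump c y -> forall k, `|y k 0 - c k 0| < 1.
Proof.
rewrite /bump lt_max ltxx/= subr_gt0 => h k.
apply: le_lt_trans h; have := mx_normrE (y - c).
rewrite /Num.Def.normr/= => ->.
have -> : y k 0 - c k 0 = (y - c) k 0 by rewrite !mxE.
by apply: (le_bigmax _ _ (k, 0)).
Qed.

Let bump_ge (c y : 'cV[R]_d) : (forall k, `|y k 0 - c k 0| < 1 / 2) -> 1 / 2 <= bump c y.
Proof.
move=> h; rewrite /bump le_max; apply/orP; right.
suff : `|y - c| <= 1 / 2 by lra.
have := mx_normrE (y - c); rewrite /Num.Def.normr/= => ->.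
apply/bigmax_leP; split; first lra.
by move=> [k l] _ /=; rewrite (ord1 l) !mxE; apply: ltW; exact: h.
Qed.

Lemma gaussian_limit_charges_balls (Z : T' -> 'cV[R]_d) (Y : R -> T -> 'cV[R]_d) :
  standard_gaussian Q Z -> cvg_in_distribution P Y Q Z ->
  (\forall t \near +oo, random_vector (Y t)) ->
  forall c : 'cV[R]_d, exists2 p, 0 < p &
    \forall t \near +oo,
      (p%:E <= P [set w | forall k, `|Y t w k 0 - c k 0| < 1]%R)%E.
Proof.
move=> [rvZ indZ lawZ] cvgY mY c.
have int01 d0 (S : measurableType d0) (m : probability S R) (f : S -> 'cV[R]_d) :
    random_vector f -> ('E_m[bump c \o f]%E <= 1)%E.
  move=> mf; rewrite unlock.
  apply: (@le_trans _ _ (\int[m]_w 1%:E)%E); last first.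
    by rewrite integral_cst//= probability_setT mule1.
  by apply: le_integral_minorant => // w _; rewrite lee_fin; case/andP: (bump01 c (f w)).
have E0 d0 (S : measurableType d0) (m : probability S R) (f : S -> 'cV[R]_d) :
    (0 <= 'E_m[bump c \o f]%E)%E.
  by apply: expectation_ge0 => w; case/andP: (bump01 c (f w)).
have fin d0 (S : measurableType d0) (m : probability S R) (f : S -> 'cV[R]_d) :
    random_vector f -> 'E_m[bump c \o f]%E \is a fin_num.
  by move=> mf; rewrite ge0_fin_numE// (le_lt_trans (int01 _ _ _ _ mf))// ltry.
(* Independence gives the cube of half-side 1/2 about [c] a product of positive normal
   probabilities, and the tent is at least 1/2 there. *)
have EZ : (0 < 'E_Q[bump c \o Z]%E)%E.
  pose F (k : 'I_d) : set R := `]c k 0 - 1 / 2, c k 0 + 1 / 2[%classic.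
  have mF k : measurable (F k) by exact: measurable_itv.
  pose G := \bigcap_(k in [set` [set: 'I_d]%SET]) (fun w => Z w k 0) @^-1` F k.
  have mG : measurable G.
    apply: fin_bigcap_measurable; first exact: finite_finset.
    by move=> k _; apply: measurable_preimageT => //; exact: measurable_entry.
  have QG : (0 < Q G)%E.
    rewrite /G indZ//.
    elim/big_ind : _ => //; first by move=> ? ?; exact: mule_gt0.
    move=> k _; rewrite lawZ//; apply: normal_prob_itv_gt0; lra.
  apply: (@lt_le_trans _ _ ((1 / 2)%:E * Q G)%E).
    by rewrite mule_gt0// lte_fin.
  rewrite unlock -integral_cst//.
  apply: le_integral_minorant => //.
  - by move=> w _; rewrite /= lee_fin; lra.
  - by move=> w _; rewrite lee_fin; case/andP: (bump01 c (Z w)).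
  - move=> w Gw; rewrite lee_fin; apply: bump_ge => k.
    have := Gw k; rewrite /= finset.in_setT /F/= in_itv/= => /(_ isT).
    by rewrite ltr_distl.
have r0 : 0 < fine 'E_Q[bump c \o Z]%E by rewrite fine_gt0// EZ -ge0_fin_numE// fin.
(* Half of the limiting expectation is eventually exceeded by the expectations along [Y t]. *)
exists (fine 'E_Q[bump c \o Z]%E / 2); first by rewrite divr_gt0.
have cv : 'E_P[bump c \o Y t]%E @[t --> +oo] --> 'E_Q[bump c \o Z]%E.
  apply: cvgY; first exact: continuous_bump.
  exists 1 => y; have /andP[h0 h1] := bump01 c y.
  by rewrite ger0_norm.
rewrite -(fineK (fin _ _ _ _ rvZ)) in cv.
have /fine_cvgP[_ cv'] := cv.
have half : fine 'E_Q[bump c \o Z]%E / 2 < fine 'E_Q[bump c \o Z]%E by lra.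
near=> t.
have mYt : random_vector (Y t) by near: t.
have ht : fine 'E_Q[bump c \o Z]%E / 2 <= fine 'E_P[bump c \o Y t]%E.
  by near: t; exact: (cvgr_ge _ cv').
apply: (@le_trans _ _ 'E_P[bump c \o Y t]%E).
  by rewrite -(fineK (fin _ _ _ _ mYt)) lee_fin.
pose S := [set w | forall k, `|Y t w k 0 - c k 0| < 1].
have mS : measurable S by exact: measurable_box.
rewrite -/S -[leRHS]mul1e -(integral_cst P mS) unlock.
rewrite [leRHS]integral_mkcond; apply: le_integral_minorant => //.
- by move=> w _; rewrite lee_fin; case/andP: (bump01 c (Y t w)).
- by move=> w _; apply: erestrict_ge0.
- move=> w _; rewrite /patch; case: ifPn => wS.
    by rewrite lee_fin; case/andP: (bump01 c (Y t w)).
  rewrite lee_fin leNgt; apply: contra wS => h.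
  by rewrite inE; exact: bump_gt0.
Unshelve. all: by end_near. Qed.

End gaussian_balls.

(** * Measurability of the discrepancy *)

Section joint_measurability.
Context {R : realType} {d : nat} {dT : measure_display}
  {T : measurableType dT} {P : probability T R} {X : R -> T -> 'cV[R]_d}.
Hypothesis levyX : levy_process P X.
Variable i : 'I_d.
Let x t w := X t w i 0.

(** For nonnegative [t], [grid n (step n t)] is the first multiple of [1 / (n + 1)] strictly after
    [t]. Strictness matters, since a right limit ignores the value at [t] itself. *)
Let step (n : nat) (t : R) : nat := (Num.truncn (n.+1%:R * t)).+1.

Let grid (n m : nat) : R := m%:R / n.+1%:R.

Let grid_gt n t : t < grid n (step n t).
Proof.
by rewrite /grid /step ltr_pdivlMr ?ltr0n// mulrC truncnS_gt.
Qed.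

Let cvg_grid t : 0 <= t -> grid n (step n t) @[n --> \oo] --> t.
Proof.
move=> t0; apply: (@squeeze_cvgr _ _ _ _ (cst t) (fun n => t + n.+1%:R^-1)).
- near=> n; rewrite (ltW (grid_gt n t))/=.
  rewrite /grid /step -natr1 mulrDl mul1r lerD2r ler_pdivrMr ?ltr0n// mulrC.
  by rewrite truncn_le// mulr_ge0.
- exact: cvg_cst.
- rewrite -[X in _ --> X]addr0; apply: cvgD; first exact: cvg_cst.
  exact: cvg_harmonic.
Unshelve. all: by end_near. Qed.

(** An upper limit of measurable functions is measurable whether or not the sequence converges, so
    the paths that fail to be right continuous need no separate treatment; on those it may be
    infinite. *)
Let xbar (t : R) (w : T) : \bar R :=
  limn_esup (fun n => (x (grid n (step n t)) w)%:E).

Let xbarE : {ae P, forall w, forall t, 0 <= t -> xbar t w = (x t w)%:E}.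
Proof.
have := levy_cadlag levyX; apply: filterS => w [rc _] t t0.
have h : x s w @[s --> t^'+] --> x t w.
  exact: (cvg_comp _ _ (rc t t0) (@coord_continuous _ _ _ i 0 (X t w))).
have /cvg_at_rightP/(_ (fun n => grid n (step n t))) h1 := h.
have h2 : x (grid n (step n t)) w @[n --> \oo] --> x t w.
  by apply: h1; split; [move=> n; exact: grid_gt|exact: cvg_grid].
have h3 : (x (grid n (step n t)) w)%:E @[n --> \oo] --> (x t w)%:E.
  by apply/fine_cvgP; split => //; exact: nearW.
rewrite /xbar limn_esup_lim; apply/cvg_lim => //.
exact: cvg_esups.
Qed.

(** Moves every time into [1, +oo[ and fixes that half-line, so that functions of time become
    measurable on the whole line. *)
Let late (t : R) : R := Num.max 1 t.

Let late_ge1 t : 1 <= late t. Proof. by rewrite /late le_max lexx. Qed.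

Let measurable_late : measurable_fun setT late.
Proof. exact: measurable_maxr. Qed.

Let measurable_xn n : measurable_fun setT
  (fun z : R * T => (x (grid n (step n (late z.1))) z.2)%:E).
Proof.
apply/measurable_EFinP => _ E mE; rewrite setTI.
(* The grid time takes countably many values, and once it is fixed only the outcome varies: the
   preimage is a countable union of rectangles. *)
rewrite (_ : _ @^-1` E = \bigcup_m
   ([set t | step n (late t) = m.+1] `*` (x (grid n m.+1) @^-1` E))); last first.
  apply/seteqP; split => -[t w] /=.
    by move=> h; exists (Num.truncn (n.+1%:R * late t)).
  by move=> [m _ [/= -> h]].
apply: bigcup_measurable => m _; apply: measurableX.
  rewrite (_ : [set t | _] = (fun t => n.+1%:R * late t) @^-1` `[m%:R, m.+1%:R[).
    apply: measurable_preimageT => //.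
    by apply: measurable_funM => //; exact: measurable_late.
  have l0 t : 0 <= n.+1%:R * late t.
    by rewrite mulr_ge0// (le_trans _ (late_ge1 t)).
  apply/seteqP; split => t /=; rewrite in_itv/= /step.
    by move=> [<-]; rewrite truncn_le ?l0// truncnS_gt.
  by move=> h; congr S; apply: truncn_def.
apply: measurable_preimageT => //; apply: levy_coord_measurable levyX i _ _.
by rewrite /grid divr_ge0.
Qed.

(** Sections of the jointly measurable event built from [xbar] have a measurable probability, and at
    each time the section differs from the event for [x] only inside one null set. *)
Lemma measurable_coord_prob (a : R -> R) : measurable_fun setT a ->
  measurable_fun setT (fun t : R => P [set w | x (late t) w <= a t]).
Proof.
move=> ma.
pose U : set (R * T) := [set z | (xbar (late z.1) z.2 <= (a z.1)%:E)%E].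
have mU : measurable U.
  rewrite -[U]setTI; apply: measurable_lee => //.
    exact: measurable_fun_limn_esup.
  by apply/measurable_EFinP; exact: measurableT_comp.
rewrite (_ : (fun _ => _) = P \o xsection U).
  exact: measurable_fun_xsection.
apply/funext => t /=.
have l0 : 0 <= late t by apply: le_trans (late_ge1 t).
have mS : measurable [set w | x (late t) w <= a t].
  by apply: measurable_sublevel; exact: levy_coord_measurable levyX i _ l0.
have mUt : measurable (xsection U t) by exact: measurable_xsection.
have [N [mN N0 sub]] := xbarE.
have out w : ~ N w -> xsection U t w <-> x (late t) w <= a t.
  move=> Nw; rewrite xsectionE /U /=.
  have -> : xbar (late t) w = (x (late t) w)%:E.
    apply: contrapT => h; apply: Nw; apply: sub => /= h'.
    by apply: h; exact: h'.
  by rewrite lee_fin.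
have le_null (S1 S2 : set T) : measurable S1 -> measurable S2 ->
    S1 `<=` S2 `|` N -> (P S1 <= P S2)%E.
  move=> m1 m2 s12; apply: le_trans (_ : P (S2 `|` N) <= _)%E.
    by apply: le_measure; rewrite ?inE//; exact: measurableU.
  apply: (@le_trans _ _ (P S2 + P N)%E); last by rewrite N0 adde0.
  exact: measureU2.
apply/eqP; rewrite eq_le; apply/andP; split; apply: le_null => // w hw;
  have [Nw|Nw] := pselect (N w); try (by right); left; exact/out.
Qed.

End joint_measurability.

(** * Distribution functions at rational levels *)

Section rational_control.
Context {R : realType} {dT dT' : measure_display}
  {T : measurableType dT} {T' : measurableType dT'}
  (P : probability T R) (Q : probability T' R).

Let right_continuous_prob d0 (S : measurableType d0) (m : probability S R)
    (U : S -> R) (z : R) : measurable_fun setT U ->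
  fine (m [set w | U w <= y]) @[y --> z^'+] --> fine (m [set w | U w <= z]).
Proof.
move=> mU.
pose V : {mfun S >-> R} := mfun_Sub (mem_set mU).
have cdfE y : cdf (V : {RV m >-> R}) y = m [set w | U w <= y].
  have -> // : [set w | U w <= y] = V @^-1` `]-oo, y].
  by apply/seteqP; split => w /=; rewrite in_itv.
have := @cdf_right_continuous _ S R m V z.
rewrite (_ : cdf _ = (fun y => m [set w | U w <= y])); last exact/funext.
move=> h; apply: fine_cvg; rewrite fineK//.
rewrite -cdfE; exact: fin_num_measure.
Qed.

(** Both distribution functions are right continuous, so a violation at [z] persists at all points
    just to its right, some of which are rational. *)
Lemma close_of_rational (U : T -> R) (V : T' -> R) (e : R) :
  measurable_fun setT U -> measurable_fun setT V ->
  (forall r : rat, `|fine (P [set w | U w <= ratr r])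
      - fine (Q [set w | V w <= ratr r])| <= e) ->
  forall z, `|fine (P [set w | U w <= z]) - fine (Q [set w | V w <= z])| <= e.
Proof.
move=> mU mV H z; rewrite leNgt; apply/negP => he.
have cv := cvg_norm (@cvgB R R^o _ _ _ _ _ _ _
  (@right_continuous_prob _ _ P U z mU) (@right_continuous_prob _ _ Q V z mV)).
have [r /= r0 hr] := cvgr_gt _ (cv _ _) _ he.
have zr : z < z + r by rewrite ltrDl.
have [q] := rat_in_itvoo zr; rewrite in_itv/= => /andP[zq qr].
have := hr (ratr q) _ zq; rewrite /ball_ /= => /(_ _)/lt_geF h.
move: (H q); rewrite h//.
by rewrite distrC gtr0_norm ?subr_gt0//; lra.
Qed.

End rational_control.

(** * Coordinates and the Kolmogorov distance *)

Section kolmogorov_coordinates.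
Context {R : realType} {d : nat} {dT dT' : measure_display}
  {T : measurableType dT} {T' : measurableType dT'}
  (P : probability T R) (Q : probability T' R).

(** A half-space bounding one coordinate is in general no orthant, but it is the increasing union of
    those whose other corner coordinates tend to infinity; bounds on orthants pass to the limit. *)
Let orthant (i : 'I_d) (q : R) (n : nat) : 'cV[R]_d :=
  \col_k (if k == i then q else n%:R).

Let cvg_orthant d0 (S : measurableType d0) (m : probability S R)
    (f : S -> 'cV[R]_d) (i : 'I_d) (q : R) :
  (forall k, measurable_fun setT (fun w => f w k 0)) ->
  m (f @^-1` [set y | forall k, y k 0 <= orthant i q n k 0]) @[n --> \oo]
    --> m [set w | f w i 0 <= q].
Proof.
move=> mf.
pose F n := f @^-1` [set y | forall k, y k 0 <= orthant i q n k 0].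
have mF n : measurable (F n).
  rewrite (_ : F n = \bigcap_(k in [set: 'I_d])
      (fun w => f w k 0) @^-1` `]-oo, orthant i q n k 0]); last first.
    apply/seteqP; split => w /=.
      by move=> h k _ /=; have := h k; rewrite in_itv.
    by move=> h k; have := h k I; rewrite /= in_itv.
  apply: fin_bigcap_measurable; first exact: finite_finset.
  by move=> k _; apply: measurable_preimageT.
have -> : [set w | f w i 0 <= q] = \bigcup_n F n.
  apply/seteqP; split => w /=.
    move=> fq; exists (Num.truncn (\sum_k `|f w k 0|)).+1 => //.
    move=> k; rewrite mxE; case: eqP => [->//|_].
    apply: ltW; apply: le_lt_trans (truncnS_gt _).
    rewrite (bigD1 k)//=; apply: le_trans (ler_norm _) _.
    by rewrite lerDl sumr_ge0.
  by move=> [n _ /(_ i)]; rewrite mxE eqxx.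
apply: nondecreasing_cvg_mu => //; first by apply: bigcup_measurable => n _; exact: mF.
move=> n1 n2 n12; apply/subsetPset => w h k; apply: le_trans (h k) _.
by rewrite !mxE; case: eqP => // _; rewrite ler_nat.
Qed.

Lemma kolmogorov_dist_ge0 (f : T -> 'cV[R]_d) (g : T' -> 'cV[R]_d) :
  (0 <= kolmogorov_dist P f Q g)%E.
Proof.
pose O := [set y : 'cV[R]_d | forall k, y k 0 <= (0 : 'cV[R]_d) k 0].
apply: (@le_trans _ _ `|P (f @^-1` O) - Q (g @^-1` O)|%E); first exact: abse_ge0.
by apply: ereal_sup_ubound; exists O => //; exists 0.
Qed.

Lemma coord_cdf_le_kolmogorov (f : T -> 'cV[R]_d) (g : T' -> 'cV[R]_d)
    (i : 'I_d) (q : R) :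
  (forall k, measurable_fun setT (fun w => f w k 0)) ->
  (forall k, measurable_fun setT (fun w => g w k 0)) ->
  (`|P [set w | (f w i 0 <= q)%R] - Q [set w | (g w i 0 <= q)%R]|
    <= kolmogorov_dist P f Q g)%E.
Proof.
move=> mf mg.
have cf := @cvg_orthant _ _ P f i q mf; have cg := @cvg_orthant _ _ Q g i q mg.
have cd : (P (f @^-1` [set y | forall k, (y k 0 <= orthant i q n k 0)%R])
    - Q (g @^-1` [set y | forall k, (y k 0 <= orthant i q n k 0)%R]))%E @[n --> \oo]
    --> (P [set w | (f w i 0 <= q)%R] - Q [set w | (g w i 0 <= q)%R])%E.
  apply: cvgeB => //; apply: fin_num_adde_defl.
  by rewrite fin_numN fin_num_measure//; exact: measurable_sublevel.
apply: cvge_to_le (cvg_abse cd) _; near=> n.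
apply: ereal_sup_ubound; exists [set y | forall k, y k 0 <= orthant i q n k 0] => //.
by exists (orthant i q n).
Unshelve. all: by end_near. Qed.

End kolmogorov_coordinates.

(** * Growth of the norming matrices *)

Section normal_concentration.
Context {R : realType}.

Lemma normal_cdf_concentrated (p : R) : 0 < p ->
  exists2 K, 0 < K & 1 - p < normal_cdf 1 K - normal_cdf 1 (- K).
Proof.
move=> p0.
pose F n : set R := `]- n%:R, n%:R]%classic.
have FT : \bigcup_n F n = setT.
  apply/seteqP; split => // z _; exists (Num.truncn `|z|).+1 => //.
  have := truncnS_gt `|z|; rewrite ltr_norml /F/= in_itv/= => /andP[-> h].
  exact: ltW.
have cF : normal_prob 0 1 (F n) @[n --> \oo] --> (1 : \bar R)%E.
  rewrite -(probability_setT (normal_prob (0 : R) 1)) -FT.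
  apply: nondecreasing_cvg_mu.
  - by move=> n; exact: measurable_itv.
  - by apply: bigcup_measurable => n _; exact: measurable_itv.
  - move=> n m nm; apply/subsetPset => z; rewrite /F/= !in_itv/=.
    have : n%:R <= m%:R :> R by rewrite ler_nat.
    by move=> h /andP[? ?]; apply/andP; split; lra.
have /fine_cvgP[_ cF'] := cF.
have lt1 : 1 - p < 1 by lra.
have [n0 _ hn] := cvgr_gt _ cF' _ lt1.
exists n0.+1%:R; first by rewrite ltr0n.
have := hn n0.+1 (leqnSn _); rewrite /= => h; apply: lt_le_trans h _.
rewrite -[leRHS]/(fine (_%:E)) normal_cdfB//.
by have := ler0n R n0.+1; lra.
Qed.

Lemma normal_close_itv {dT : measure_display} {T : measurableType dT}
    (P : probability T R) (U : T -> R) (s e K : R) :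
  measurable_fun setT U -> 0 < s -> 0 < K -> normal_close P U s e ->
  ((normal_cdf 1 K - normal_cdf 1 (- K) - (e + e))%:E
    <= P [set w | - (K * s) < U w <= K * s]%R)%E.
Proof.
move=> mU s0 K0 H.
have mray z : measurable [set w | U w <= z] by exact: measurable_sublevel.
have -> : [set w | - (K * s) < U w <= K * s]
    = [set w | U w <= K * s] `\` [set w | U w <= - (K * s)].
  apply/seteqP; split => w /=.
    by move=> /andP[h1 h2]; split => //; apply/negP; rewrite -ltNge.
  by move=> [h1 /negP]; rewrite -ltNge h1 => ->.
have sub : [set w | U w <= - (K * s)] `<=` [set w | U w <= K * s].
  by move=> w /= /le_trans; apply; have := mulr_gt0 K0 s0; lra.
rewrite measureD//; last by rewrite -ge0_fin_numE// fin_num_measure.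
rewrite setIidr//.
rewrite -[X in (X - _)%E]fineK ?fin_num_measure//.
rewrite -[X in (_ - X)%E]fineK ?fin_num_measure//.
rewrite -EFinB lee_fin.
have := H (K * s); rewrite (normal_cdfE _ s0) mulfK ?gt_eqF// ler_norml => /andP[? ?].
have := H (- (K * s)); rewrite (normal_cdfE _ s0) -mulNr mulfK ?gt_eqF//.
by rewrite mulNr ler_norml => /andP[? ?]; lra.
Qed.

End normal_concentration.

Section norming_growth.
Context {R : realType} {d : nat} {dT dT' : measure_display}
  {T : measurableType dT} {P : probability T R}
  {T' : measurableType dT'} {Q : probability T' R}
  {Z : T' -> 'cV[R]_d} {X : R -> T -> 'cV[R]_d}
  {A : R -> 'cV[R]_d} {B : R -> 'M[R]_d}.
Hypothesis gaussZ : standard_gaussian Q Z.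
Hypothesis levyX : levy_process P X.
Hypothesis measA : measurable_from1 A.
Hypothesis measB : measurable_from1 B.
Hypothesis unitB : \forall t \near +oo, B t \in unitmx.

Let measZ i : measurable_fun setT (fun w => Z w i 0).
Proof. by have [rvZ _ _] := gaussZ; exact: measurable_entry. Qed.

Let row_norm i t := Num.sqrt (\sum_l B t i l ^+ 2).

Let row_norm_gt0 i t : B t \in unitmx -> 0 < row_norm i t.
Proof.
move=> uB; rewrite sqrtr_gt0 lt_neqAle sumr_ge0 ?andbT; last first.
  by move=> l _; exact: sqr_ge0.
rewrite eq_sym; apply/negP => /eqP /psumr_eq0P h.
have B0 l : B t i l = 0.
  by apply/eqP; rewrite -sqrf_eq0; apply/eqP/h => // k _; exact: sqr_ge0.
have : (B t *m invmx (B t)) i i = 0.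
  by rewrite mxE big1// => l _; rewrite B0 mul0r.
by rewrite mulmxV// mxE eqxx => /eqP; rewrite oner_eq0.
Qed.

Let row_law i t z : B t \in unitmx ->
  Q [set w | (B t *m Z w) i 0 <= z] = normal_prob 0 (row_norm i t) `]-oo, z].
Proof.
move=> uB; have := row_norm_gt0 i uB.
rewrite /row_norm => h.
rewrite -(gaussian_combination gaussZ measZ (b := B t i))//.
  by congr (Q _); apply/seteqP; split => w /=; rewrite mxE in_itv.
apply: contrapT => nb; move: h; rewrite big1 ?sqrtr0 ?ltxx// => l _.
by apply/eqP; rewrite sqrf_eq0; apply/negPn/negP => hl; apply: nb; exists l.
Qed.

Let late (t : R) : R := Num.max 1 t.

(** Enumerates the rationals; the default 0 serves the codes that decode to nothing. *)
Let rational (n : nat) : R := ratr (odflt 0 (unpickle n) : rat).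

(** The measurable minorant of the Kolmogorov distance at times at least 1. Being a supremum over
    countably many levels ([esups] at 0 ranges over all [n]), it inherits the measurability of each
    term. *)
Let discrepancy i t : \bar R := esups (fun n =>
  `| P [set w | (X (late t) w i 0 - A (late t) i 0 <= rational n)%R]
     - Q [set w | ((B (late t) *m Z w) i 0 <= rational n)%R] |%E) 0%N.

Let measurable_late : measurable_fun setT late.
Proof. exact: measurable_maxr. Qed.

Let measurable_comp_late m n (F : R -> 'M[R]_(m, n)) i j :
  measurable_from1 F -> measurable_fun setT (fun t => F (late t) i j).
Proof.
move=> mF; have := measurable_entry i j mF => h.
apply: (measurable_comp _ _ h measurable_late) => //.
by move=> _ [t _ <-] /=; rewrite in_itv/= andbT /late le_max lexx.
Qed.

Let measurable_discrepancy i : measurable_fun setT (discrepancy i).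
Proof.
apply: measurable_fun_esups => n; apply: measurableT_comp => //.
apply: emeasurable_funB.
  have := measurable_coord_prob levyX i
    (a := fun t => rational n + A (late t) i 0).
  rewrite (_ : (fun t : R => P _) = (fun t : R =>
     P [set w | X (late t) w i 0 - A (late t) i 0 <= rational n])).
    apply; apply: measurable_funD => //; exact: measurable_comp_late.
  by apply/funext => t; congr (P _); apply/seteqP; split => w /=; rewrite lerBlDr.
pose U : set (R * T') := (fun z => \sum_l B (late z.1) i l * Z z.2 l 0)
  @^-1` `]-oo, rational n].
have mU : measurable U.
  apply: measurable_preimageT => //; apply: measurable_sum => l.
  apply: measurable_funM.
    by apply: (measurableT_comp (measurable_comp_late i l measB)).
  by apply: (measurableT_comp (measZ l)).
rewrite (_ : (fun _ => _) = Q \o xsection U).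
  exact: measurable_fun_xsection.
apply/funext => t /=; congr (Q _); apply/seteqP; split => w /=.
  by rewrite xsectionE /U/= in_itv/= mxE.
by rewrite xsectionE /U/= in_itv/= mxE.
Qed.

Let discrepancy_ge0 i t : (0 <= discrepancy i t)%E.
Proof.
by apply: ereal_sup_ge; eexists; [exists 0%N; [|reflexivity]|].
Qed.

Let measurable_centred i t : 0 <= t ->
  measurable_fun setT (fun w => X t w i 0 - A t i 0).
Proof.
by move=> t0; apply: measurable_funB => //; exact: levy_coord_measurable levyX i t t0.
Qed.

Let measurable_BZ i t : measurable_fun setT (fun w => (B t *m Z w) i 0).
Proof.
rewrite (_ : (fun _ => _) = fun w => \sum_l B t i l * Z w l 0).
  by apply: measurable_sum => l; exact: measurable_funM.
by apply/funext => w; rewrite mxE.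
Qed.

Let discrepancy_le i t : 1 <= t -> (discrepancy i t
  <= kolmogorov_dist P (fun w => (X t w - A t)%R) Q (fun w => (B t *m Z w)%R))%E.
Proof.
move=> t1; have t0 : 0 <= t by lra.
apply: ge_ereal_sup => _ [n _ <-].
rewrite /late max_r//.
have := @coord_cdf_le_kolmogorov R d _ _ T T' P Q (fun w => X t w - A t)
  (fun w => B t *m Z w) i (rational n).
have -> : [set w | (X t w - A t) i 0 <= rational n]
   = [set w | X t w i 0 - A t i 0 <= rational n].
  by apply/seteqP; split => w /=; rewrite !mxE.
apply => k; last exact: measurable_BZ.
rewrite (_ : (fun _ => _) = fun w => X t w k 0 - A t k 0).
  exact: measurable_centred.
by apply/funext => w; rewrite !mxE.
Qed.

Let close_of_discrepancy i t : 1 <= t -> B t \in unitmx ->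
  normal_close P (fun w => X t w i 0 - A t i 0) (row_norm i t)
    (fine (discrepancy i t)).
Proof.
move=> t1 uB z; have t0 : 0 <= t by lra.
have bound n : (`|P [set w | (X t w i 0 - A t i 0 <= rational n)%R]
    - Q [set w | ((B t *m Z w) i 0 <= rational n)%R]| <= discrepancy i t)%E.
  by apply: ereal_sup_ubound; exists n => //=; rewrite /late max_r.
(* Finiteness matters because [fine] would turn an infinite bound into 0. *)
have fin : discrepancy i t \is a fin_num.
  rewrite ge0_fin_numE//; apply: (@le_lt_trans _ _ 1%E); last by rewrite ltry.
  apply: ge_ereal_sup => _ [n _ <-]; rewrite /late max_r//.
  have m1 := measurable_sublevel (rational n) (measurable_centred i t0).
  have m2 := measurable_sublevel (rational n) (measurable_BZ i t).
  rewrite -[X in `|X - _|%E]fineK ?fin_num_measure//.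
  rewrite -[X in `|_ - X|%E]fineK ?fin_num_measure//.
  rewrite -EFinB lee_fin ler_norml.
  have h1 : 0 <= fine (P [set w | X t w i 0 - A t i 0 <= rational n]) <= 1.
    by rewrite fine_ge0//= -lee_fin fineK ?fin_num_measure// probability_le1.
  have h2 : 0 <= fine (Q [set w | (B t *m Z w) i 0 <= rational n]) <= 1.
    by rewrite fine_ge0//= -lee_fin fineK ?fin_num_measure// probability_le1.
  by move: h1 h2 => /andP[? ?] /andP[? ?]; apply/andP; split; lra.
rewrite /normal_cdf -row_law//.
apply: (@close_of_rational R _ _ _ _ P Q (fun w => X t w i 0 - A t i 0)
  (fun w => (B t *m Z w) i 0)).
- exact: measurable_centred.
- exact: measurable_BZ.
- move=> r; have := bound (pickle r); rewrite /rational pickleK/=.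
  have m1 := measurable_sublevel (ratr r) (measurable_centred i t0).
  have m2 := measurable_sublevel (ratr r) (measurable_BZ i t).
  rewrite -[X in (`|X - _| <= _)%E]fineK ?fin_num_measure//.
  rewrite -[X in (`|_ - X| <= _)%E]fineK ?fin_num_measure//.
  by rewrite -EFinB -(fineK fin) lee_fin.
Qed.

Hypothesis L1 : L1loc_infty (fun t : R =>
  (t^-1%:E * kolmogorov_dist P (fun w => (X t w - A t)%R)
                             Q (fun w => (B t *m Z w)%R))%E).

Let dyadic_close i : exists s C (e : nat -> R), [/\ 1 <= s, 0 < C,
  e @ \oo --> (0 : R),
  forall k, normal_close P
    (fun w => X (2 ^+ k * s) w i 0 - A (2 ^+ k * s) i 0)
    (row_norm i (2 ^+ k * s)) (e k)
  & forall k, 0 < row_norm i (2 ^+ k * s) <= C * Num.sqrt (2 ^+ k)].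
Proof.
have [M [M0 intM]] := L1.
have [M1 [_ hM1]] := unitB.
(* Beyond [N] the integral is finite, [late] acts trivially and [B] is invertible; the [+ 1] makes
   the bound by [M1] strict. *)
pose N := Num.max M (Num.max 1 (M1 + 1)).
have NM : M <= N by rewrite le_max lexx.
have N1 : 1 <= N by rewrite !le_max lexx !orbT.
have NM1 : M1 < N by rewrite !lt_max ltrDl ltr01 !orbT.
have N0 : 0 < N by lra.
have intN : (\int[lebesgue_measure]_(t in `[N, +oo[) (t^-1%:E * discrepancy i t)
    < +oo)%E.
  apply: le_lt_trans intM; apply: le_integral_minorant.
  - by move=> t /=; rewrite !in_itv/= !andbT; exact: le_trans.
  - move=> t /=; rewrite in_itv/= andbT => Nt.
    by rewrite mule_ge0// lee_fin invr_ge0; lra.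
  - move=> t /=; rewrite in_itv/= andbT => Mt.
    rewrite mule_ge0 ?kolmogorov_dist_ge0// lee_fin invr_ge0; lra.
  - move=> t /=; rewrite in_itv/= andbT => Nt.
    rewrite lee_wpmul2l ?lee_fin ?invr_ge0//; first lra.
    by apply: discrepancy_le; lra.
have [s Ns fins] := dyadic_summable N0 (measurable_discrepancy i)
  (discrepancy_ge0 i) intN.
pose t k := 2 ^+ k * s.
have ts k : s <= t k.
  by rewrite /t ler_peMl ?exprn_ege1//; lra.
have uB k : B (t k) \in unitmx.
  by apply: hM1; have := ts k; lra.
have t1 k : 1 <= t k by have := ts k; lra.
pose S := fine (\sum_(k <oo) discrepancy i (t k))%E.
have SE : (S%:E = \sum_(k <oo) discrepancy i (t k))%E.
  by rewrite /S fineK// ge0_fin_numE//; exact: nneseries_ge0.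
pose e k := fine (discrepancy i (t k)).
have partial n : (\sum_(0 <= k < n) discrepancy i (t k) <= S%:E)%E.
  by rewrite SE; exact: nneseries_lim_ge.
have eE k : ((e k)%:E = discrepancy i (t k))%E.
  rewrite /e fineK// ge0_fin_numE//.
  apply: le_lt_trans (ltry S); apply: le_trans (partial k.+1).
  by rewrite big_nat_recr//= leeDr// sume_ge0.
have e0 k : 0 <= e k by rewrite /e fine_ge0.
have eS n : \sum_(0 <= k < n) e k <= S.
  by rewrite -lee_fin -sumEFin; under eq_bigr do rewrite eE.
have close k := close_of_discrepancy i (t1 k) (uB k).
have cve : e @ \oo --> (0 : R).
  apply: cvg_series_cvg_0; apply: nondecreasing_is_cvgn.
    by apply/nondecreasing_seqP => n; rewrite /series/= big_nat_recr//= lerDl.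
  by exists S => _ [n _ <-]; exact: eS.
pose c0 := normal_pdf 0 1 (1 : R).
have c00 : 0 <= c0^-1 by rewrite invr_ge0 normal_pdf_ge0.
(* Each doubling multiplies [Num.sqrt (2 ^+ k)] by [Num.sqrt 2], exactly the factor in
   [levy_coord_scale], which thus becomes a recursion for [r] alone. *)
pose r k := row_norm i (t k) / Num.sqrt (2 ^+ k).
have q0 k : 0 < Num.sqrt (2 ^+ k) :> R by rewrite sqrtr_gt0 exprn_gt0.
have [C hC] : exists C, forall k, r k <= C.
  (* In the defect [e k] counts twice, for the two copies at time [t k], and [e k.+1] once, for the
     doubled time; each of the three partial sums is at most [S]. *)
  apply: (@bounded_of_summable_defect R r (fun k => e k + e k + e k.+1)
    c0^-1 (S + S + S)) => //.
  - by move=> k; rewrite /r divr_ge0 ?sqrtr_ge0.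
  - by move=> k; rewrite !addr_ge0.
  - move=> n; rewrite !big_split/= !lerD//.
    apply: le_trans (eS n.+1); rewrite big_nat_recl//= lerDr//.
  - move=> k.
    have t0 : 0 < t k by have := t1 k; lra.
    have tS : t k.+1 = 2 * t k by rewrite /t exprS mulrA.
    have := close k.+1; rewrite tS => close'.
    have h0 := row_norm_gt0 i (uB k.+1); rewrite tS in h0.
    have := levy_coord_scale levyX t0 (row_norm_gt0 i (uB k)) h0 (close k) close'.
    rewrite -/(e k) -tS -/(e k.+1) -/c0 => h.
    rewrite /r ler_pdivlMr// mulrAC (mulrC c0^-1).
    rewrite exprS sqrtrM// invfM.
    rewrite (_ : row_norm i (t k.+1) * _ * _ * _ =
       row_norm i (t k.+1) * (1 - (e k + e k + e k.+1) / c0) / Num.sqrt 2); last first.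
      have n2 : Num.sqrt 2 != 0 :> R by rewrite gt_eqF// sqrtr_gt0.
      have nk : Num.sqrt (2 ^+ k) != 0 :> R by rewrite gt_eqF.
      have nc : c0 != 0 by rewrite gt_eqF// normal_pdf_gt0// oner_neq0.
      by field; rewrite n2 nc nk.
    by rewrite ler_pdivrMr ?sqrtr_gt0// [leRHS]mulrC.
exists s, (Num.max C 1), e; split => //.
- lra.
- by rewrite lt_max ltr01 orbT.
- move=> k; rewrite -/(t k) row_norm_gt0//=.
  by rewrite -ler_pdivrMr// (le_trans (hC k))// le_max lexx.
Qed.

Context {A0 : R -> 'cV[R]_d} {B0 : R -> 'M[R]_d}.
Hypothesis normB0 : attracting_norming P X Q Z A0 B0.

Let unitB0 t : 1 <= t -> B0 t \in unitmx.
Proof.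
have [_ _ pd _] := normB0; move=> /pd [_ pos].
rewrite unitmxE unitfE; apply/negP => /det0P [v v0 vB].
have := pos v^T; rewrite trmxK vB mul0mx mxE ltxx trmx_eq0.
by move=> /(_ v0).
Qed.

Let standardized t w := invmx (B0 t) *m (X t w - A0 t).

Let standardized_random t : 0 <= t -> random_vector (standardized t).
Proof. by move=> t0; apply: random_vector_affine; exact: levy_measurable levyX t t0. Qed.

Let balls_charged : exists2 p, 0 < p & \forall t \near +oo,
  forall (j : 'I_d) (b : bool), (p%:E <= P [set w | forall k,
    `|standardized t w k 0
      - (((-1) ^+ b * d.+1%:R) *: delta_mx j 0 : 'cV[R]_d) k 0| < 1]%R)%E.
Proof.
have [_ _ _ cvgB0] := normB0.
have rv : \forall t \near +oo, random_vector (standardized t).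
  by near=> t; apply: standardized_random; near: t; apply: nbhs_pinfty_ge; exact: num_real.
have H (jb : 'I_d * bool) := gaussian_limit_charges_balls gaussZ cvgB0 rv
  (((-1) ^+ jb.2 * d.+1%:R) *: delta_mx jb.1 0 : 'cV[R]_d).
have /choice [p hp] : forall jb : 'I_d * bool, exists p, 0 < p /\
   \forall t \near +oo, (p%:E <= P [set w | forall k,
    `|standardized t w k 0
      - (((-1) ^+ jb.2 * d.+1%:R) *: delta_mx jb.1 0 : 'cV[R]_d) k 0| < 1]%R)%E.
  by move=> jb; have [p p0 hp] := H jb; exists p.
exists (\big[Num.min/1]_jb p jb).
  elim/big_ind : _ => //; first by move=> u v u0 v0; rewrite lt_min u0.
  by move=> jb _; have [] := hp jb.
have : \forall t \near +oo, forall jb : 'I_d * bool, ((p jb)%:E <= P [set w | forall k,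
    `|standardized t w k 0
      - (((-1) ^+ jb.2 * d.+1%:R) *: delta_mx jb.1 0 : 'cV[R]_d) k 0| < 1]%R)%E.
  by apply: filter_forall => jb; have [] := hp jb.
apply: filterS => t ht j b; apply: le_trans (ht (j, b)).
by rewrite lee_fin; apply: bigmin_le.
Unshelve. all: by end_near. Qed.

Let row_bound i : exists C, \forall t \near +oo,
  forall j, `|B0 t i j| <= C * Num.sqrt t.
Proof.
have [s [C [e [s1 C0 cve close bound]]]] := dyadic_close i.
have [p p0 balls] := balls_charged.
(* The normal interval carries more than [1 - p / 2]; subtracting two errors below [p / 8] still
   leaves more than [1 - p]. *)
have p2 : 0 < p / 2 by lra.
have [K K0 hK] := normal_cdf_concentrated p2.
have p8 : 0 < p / 8 by lra.
have [k1 _ hk1] := cvgr_lt _ cve _ p8.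
(* With k the dyadic bracket of [t / s], the slab has half-width at most
   [K * C * Num.sqrt (2 ^+ k.+1)], and [2 ^+ k <= t / s <= t] because [s] is at least 1. *)
exists (K * C * Num.sqrt 2); near=> t.
have ts : 2 ^+ k1 * s <= t by near: t; apply: nbhs_pinfty_ge; exact: num_real.
have t1 : 1 <= t by near: t; apply: nbhs_pinfty_ge; exact: num_real.
have s0 : 0 < s by lra.
have t0 : 0 < t by lra.
have k10 : 1 <= 2 ^+ k1 :> R by rewrite exprn_ege1//; lra.
have ts1 : 1 <= t / s by rewrite ler_pdivlMr// mul1r (le_trans _ ts)// ler_peMl// ltW.
have [k [hk hkS]] := dyadic_bracket ts1.
(* Since [t] is past the dyadic time of index [k1], so is the next dyadic point, where the error is
   below [p / 8]. *)
have k1k : (k1 <= k.+1)%N.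
  have : 2 ^+ k1 < 2 ^+ k.+1 :> R.
    by apply: le_lt_trans hkS; rewrite ler_pdivlMr.
  by rewrite ltr_eXn2l; [exact: ltnW|lra].
pose u := 2 ^+ k.+1 * s.
have tu : t < u by rewrite /u -ltr_pdivrMr.
have /andP[n0 nC] := bound k.+1; rewrite -/u in n0 nC.
have u0 : 0 <= u by lra.
have mU : measurable_fun setT (fun w => X u w i 0 - A u i 0) by exact: measurable_centred.
have := normal_close_itv mU n0 K0 (close k.+1).
set r := K * row_norm i u => hitv.
have hu : ((1 - p)%:E < P [set w | A u i 0 - r < X u w i 0 <= A u i 0 + r]%R)%E.
  have -> : [set w | A u i 0 - r < X u w i 0 <= A u i 0 + r]
      = [set w | - r < X u w i 0 - A u i 0 <= r].
    by apply/seteqP; split => w /=; rewrite ltrBrDr lerBlDl (addrC (- r)).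
  apply: lt_le_trans hitv; rewrite lte_fin.
  by have := hk1 k.+1 k1k; rewrite /=; lra.
have [b hb] := levy_coord_concentrated levyX t0 tu hu.
have B0r : forall j, `|B0 t i j| <= r.
  apply: (row_bound_of_slab (P := P) (a0 := A0 t) (X := X t) (p := p) (a := b)) => //.
  - by apply: (levy_measurable levyX); lra.
  - exact: unitB0.
  - by near: t.
move=> j; apply: le_trans (B0r j) _.
rewrite /r -!mulrA ler_pM2l//; apply: le_trans nC _.
rewrite ler_pM2l// -sqrtrM//.
rewrite ler_wsqrtr// exprS ler_pM2l//.
apply: le_trans hk _; rewrite ler_pdivrMr// ler_peMr//; lra.
Unshelve. all: by end_near. Qed.

Lemma normal_attraction_of_summable : domain_of_normal_attraction P X Q Z.
Proof.
exists A0, B0; split => //.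
have /choice [C hC] := row_bound.
have : \forall t \near +oo, forall i j, `|B0 t i j| <= C i * Num.sqrt t.
  exact: filter_forall.
move=> hall.
apply: (@le_lt_trans _ _ (\sum_i C i)%:E); last by rewrite ltry.
apply: ereal_inf_le => /=.
(* An upper limit is at most the supremum over any one neighbourhood of infinity, here one where the
   entry bounds hold and division by [Num.sqrt t] is legitimate. *)
exists (ereal_sup ((fun t : R => ((Num.sqrt t)^-1 * \tr (B0 t))%:E) @`
  [set t | 0 < t /\ forall i j, `|B0 t i j| <= C i * Num.sqrt t])).
  exists [set t | 0 < t /\ forall i j, `|B0 t i j| <= C i * Num.sqrt t] => //.
  near=> t; split; first by near: t; apply: nbhs_pinfty_gt; exact: num_real.
  by near: t.
apply: ge_ereal_sup => _ [t [t0 ht] <-]; rewrite lee_fin.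
rewrite mulrC ler_pdivrMr ?sqrtr_gt0// mulr_suml /mxtrace.
apply: ler_sum => i _; apply: le_trans (ht i i); exact: ler_norm.
Unshelve. all: by end_near. Qed.

End norming_growth.

Theorem corollary1p4 (R : realType) (d : nat) (d_gt0 : (0 < d)%N)
    (dT : measure_display) (T : measurableType dT) (P : probability T R)
    (dT' : measure_display) (T' : measurableType dT') (Q : probability T' R)
    (Z : T' -> 'cV[R]_d) (gaussZ : standard_gaussian Q Z)
    (X : R -> T -> 'cV[R]_d) (levyX : levy_process P X)
    (nonnormalX : domain_of_nonnormal_attraction P X Q Z)
    (A : R -> 'cV[R]_d) (B : R -> 'M[R]_d)
    (measA : measurable_from1 A) (measB : measurable_from1 B)
    (unitB : \forall t \near +oo, B t \in unitmx)
    (colB : forall j : 'I_d,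
       ((delta_mx j 0 : 'cV[R]_d)^T *m (B t)^T *m B t
          *m (delta_mx j 0 : 'cV[R]_d)) 0 0 @[t --> +oo] --> +oo)
    (slowB : forall f : R -> R,
       (forall t, 1 <= t -> 1 <= f t) ->
       (forall s t, 1 <= s -> s <= t -> f s <= f t) ->
       f t / t @[t --> +oo] --> (1 : R) ->
       invmx (B t) *m B (f t) @[t --> +oo] --> (1%:M : 'M[R]_d)) :
  ~ L1loc_infty (fun t : R =>
      (t^-1%:E * kolmogorov_dist P (fun w => (X t w - A t)%R)
                                 Q (fun w => (B t *m Z w)%R))%E).
Proof.
move=> intd; have [[A0 [B0 normB0]] nonnormal] := nonnormalX.
apply: nonnormal.
exact: (normal_attraction_of_summable gaussZ levyX measA measB unitB intd
  normB0).
Qed.
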